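(* Let $\lambda>0$ and $0<\nu\le1$. Then the solution $u_\nu$ of $\frac{\partial^{\nu}u}{\partial t^{\nu}}=\lambda^{2}\frac{\partial^{2}u}{\partial x^{2}}$, $x\in\mathbb{R}$, $t>0$, $u(x,0)=\delta(x)$, satisfies \[ u_{\nu}(x,t)=\int_{0}^{\infty}\frac{1}{\sqrt{4\pi w\lambda}}e^{-x^{2}/(4w\lambda)}\,\overline{u}_{2\nu}(w,t)\,dw, \] where $\overline{u}_{2\nu}(w,t)=2u_{2\nu}(w,t)$ for $w\ge0$ and $\overline{u}_{2\nu}(w,t)=0$ for $w<0$, and $u_{2\nu}$ is the solution of $\frac{\partial^{2\nu}u}{\partial t^{2\nu}}=\lambda^{2}\frac{\partial^{2}u}{\partial x^{2}}$ with $u(x,0)=\delta(x)$ when $0<\nu\le\frac12$, and with $u(x,0)=\delta(x)$, $u_t(x,0)=0$ when $\frac12<\nu\le1$.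
   Context: Fractional time derivatives are in the Dzherbashyan–Caputo sense: for $m-1<\mu<m$, $\frac{\partial^{\mu}u}{\partial t^{\mu}}(x,t)=\frac{1}{\Gamma(m-\mu)}\int_0^t (t-s)^{m-\mu-1}\frac{\partial^m u}{\partial s^m}(x,s)\,ds$, and for $\mu=m$ the ordinary derivative. For $0<\mu\le2$ the solution with the stated initial conditions is $u_\mu(x,t)=\frac{1}{2\lambda t^{\mu/2}}\sum_{k\ge0}\frac{(-|x|/(\lambda t^{\mu/2}))^k}{k!\,\Gamma(-\mu k/2+1-\mu/2)}$.
   Formalization: At ν=1 the series for u_2 vanishes identically (the true solution is a sum of deltas), so the literal integral is 0; this case is stated instead as u_1(x,t) equal to the Gaussian kernel at w=λt, i.e. the integral against the delta at λt; solutions u_μ are the given series. *)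

(* Defs.v *)
From Stdlib Require Import Reals Factorial.
From Coquelicot Require Import Coquelicot.
Open Scope R_scope.

Fixpoint rising (z : R) (n : nat) : R :=
  match n with
  | O => 1
  | S m => rising z m * (z + INR m)
  end.

(* Reciprocal Gamma function 1/Gamma(z), via Gauss' product formula
   1/Gamma(z) = lim_n z(z+1)...(z+n) / (n! n^z).
   This is an entire function, equal to 0 at the poles z = 0,-1,-2,... of Gamma. *)
Definition rgamma (z : R) : R :=
  real (Lim_seq (fun n => rising z (S n) / (INR (Factorial.fact n) * exp (z * ln (INR n))))).

(* The fundamental solution of the time-fractional equation
   d^mu u / dt^mu = lam^2 u_xx, given in the context:
   u_mu(x,t) = 1/(2 lam t^{mu/2}) sum_k (-|x|/(lam t^{mu/2}))^k / (k! Gamma(-mu k/2 + 1 - mu/2)). *)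
Definition u_sol (mu lam x t : R) : R :=
  / (2 * lam * Rpower t (mu / 2)) *
  Series (fun k => (- Rabs x / (lam * Rpower t (mu / 2))) ^ k / INR (Factorial.fact k)
                   * rgamma (- mu * INR k / 2 + 1 - mu / 2)).

Definition ubar (mu lam w t : R) : R :=
  if Rle_dec 0 w then 2 * u_sol mu lam w t else 0.

Definition gauss_kernel (lam x w : R) : R :=
  / sqrt (4 * PI * w * lam) * exp (- x ^ 2 / (4 * w * lam)).

(* Main.v *)
Require Import Defs.
From Corelib Require Import ssreflect.
From Stdlib Require Import Reals Lra Lia.
From Coquelicot Require Import Coquelicot.
Open Scope R_scope.

(** Write [M_mu (y) = sum_k (- y)^k / (k! Gamma (1 - mu - mu k))]; up to scaling, [u_nu] is
    [M_{nu/2}] and [ubar_{2 nu}] is [M_nu]. Euler's integral of [Gamma], taken along a ray, and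
    the reflection formula give Hankel's representation: [M_mu (y)] is the integral of
    [exp (z - y z^mu) z^{mu - 1} / (2 i pi)] over the two rays [arg z = phi] and [arg z = - phi].
    For [phi = pi / (1 + nu)] both [Re z < 0] and [Re z^nu > 0] hold on these rays, so that
    Fubini applies when [M_nu] is integrated against the Gaussian kernel; the inner integral is
    [int (pi y)^{-1/2} exp (- xi^2 / (4 y) - p y) dy = p^{-1/2} exp (- xi p^{1/2})] at
    [p = z^nu], and what remains is Hankel's representation of [M_{nu/2} (xi)]. All the
    integrals are written over the real line, with [|z| = e^s] and [y = e^tau], and complex
    quantities through imaginary parts up to an arbitrary phase. *)

(** * Integrals over the real line *)

(** The [rgamma] of the statement is Gauss' limit, whereas the contour yields Euler's integral;
    moreover the series needs [1 / Gamma] at [1 - a] with [a > 0], mostly outside the range of that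
    integral. The bridge is the reflection formula, built from elementary pieces: Gauss' limit on
    [(0, 1)] from log-convexity of Euler's integral, the sine product from moments of powers of the
    cosine, and a step of one in the argument for the rest. The second obstacle is the exchange of
    integrals over two infinite lines. Fubini is proved only on rectangles; the contour is exhausted
    while the range [[A, B]] of [tau] stays fixed, and the cost of truncating [tau] is an explicit
    exponential whose coefficient remains integrable along the contour. This is why the intermediate
    results carry rates rather than mere limits. At [nu = 1] both [phi] and [nu phi] become [pi / 2]
    and the damping is lost, so this case is computed from the series. *)

Ltac smooth := intros; apply: ex_derive_continuous; auto_derive; auto.

(* [RInt] equations are elaborated at the carrier of a normed module, which hides [R] from
   [ring] and [field]. *)
Ltac toR := match goal with |- @eq _ ?a ?b => change (@eq R a b) end.

Lemma ex_RInt_cont (f : R -> R) (a b : R) :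
  (forall s, continuous f s) -> ex_RInt f a b.
Proof. intros H; apply: ex_RInt_continuous; intros; apply H. Qed.

Lemma RInt_plus_cont (f g : R -> R) (a b : R) :
  (forall s, continuous f s) -> (forall s, continuous g s) ->
  RInt (fun s => f s + g s) a b = RInt f a b + RInt g a b.
Proof.
  intros Hf Hg; apply: RInt_plus; now apply ex_RInt_cont.
Qed.

Lemma RInt_minus_cont (f g : R -> R) (a b : R) :
  (forall s, continuous f s) -> (forall s, continuous g s) ->
  RInt (fun s => f s - g s) a b = RInt f a b - RInt g a b.
Proof.
  intros Hf Hg; apply: RInt_minus; now apply ex_RInt_cont.
Qed.

Lemma RInt_scal_cont (f : R -> R) (c a b : R) :
  (forall s, continuous f s) ->
  RInt (fun s => c * f s) a b = c * RInt f a b.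
Proof.
  intros Hf; apply: RInt_scal; now apply ex_RInt_cont.
Qed.

Lemma RInt_Chasles_cont (f : R -> R) (a b c : R) :
  (forall s, continuous f s) -> RInt f a b + RInt f b c = RInt f a c.
Proof.
  intros Hf; apply: RInt_Chasles; now apply ex_RInt_cont.
Qed.

Lemma RInt_of_derive (F f : R -> R) (a b : R) :
  (forall s, is_derive F s (f s)) -> (forall s, continuous f s) ->
  RInt f a b = F b - F a.
Proof.
  intros HF Hf.
  apply: is_RInt_unique; apply: is_RInt_derive; intros; auto.
Qed.

Lemma RInt_exp (k a b : R) : k <> 0 ->
  RInt (fun s => exp (k * s)) a b = (exp (k * b) - exp (k * a)) / k.
Proof.
  intros Hk.
  transitivity (exp (k * b) / k - exp (k * a) / k); [| toR; field; auto].
  apply (RInt_of_derive (fun s => exp (k * s) / k)).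
  - intros s; auto_derive; auto; field; auto.
  - smooth.
Qed.

Lemma abs_RInt_le_cont (f g : R -> R) (a b : R) : a <= b ->
  (forall s, continuous f s) -> (forall s, continuous g s) ->
  (forall s, Rabs (f s) <= g s) -> Rabs (RInt f a b) <= RInt g a b.
Proof.
  intros Hab Hf Hg H.
  apply (norm_RInt_le f g a b (RInt f a b) (RInt g a b) Hab).
  - intros; apply H.
  - apply: RInt_correct; now apply ex_RInt_cont.
  - apply: RInt_correct; now apply ex_RInt_cont.
Qed.

Lemma abs_RInt_left (f : R -> R) (a C A B : R) : 0 < a -> A <= B ->
  (forall s, continuous f s) -> (forall s, Rabs (f s) <= C * exp (a * s)) ->
  Rabs (RInt f A B) <= C / a * exp (a * B).
Proof.
  intros Ha HAB Hf Hb.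
  apply Rle_trans with (RInt (fun s => C * exp (a * s)) A B).
  - apply abs_RInt_le_cont; auto; smooth.
  - rewrite -> RInt_scal_cont by smooth.
    rewrite -> RInt_exp by lra.
    assert (HC : 0 <= C).
    { generalize (Rle_trans _ _ _ (Rabs_pos _) (Hb 0)); rewrite Rmult_0_r exp_0; lra. }
    assert (0 <= C / a * exp (a * A)).
    { apply Rmult_le_pos; [apply Rdiv_le_0_compat; lra | apply Rlt_le, exp_pos]. }
    unfold Rdiv in *; lra.
Qed.

Lemma abs_RInt_right (f : R -> R) (d D A B : R) : 0 < d -> A <= B ->
  (forall s, continuous f s) -> (forall s, Rabs (f s) <= D * exp (- d * s)) ->
  Rabs (RInt f A B) <= D / d * exp (- d * A).
Proof.
  intros Hd HAB Hf Hb.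
  apply Rle_trans with (RInt (fun s => D * exp (- d * s)) A B).
  - apply abs_RInt_le_cont; auto; smooth.
  - rewrite -> RInt_scal_cont by smooth.
    rewrite -> RInt_exp by lra.
    assert (HC : 0 <= D).
    { generalize (Rle_trans _ _ _ (Rabs_pos _) (Hb 0)); rewrite Rmult_0_r exp_0; lra. }
    assert (0 <= D / d * exp (- d * B)).
    { apply Rmult_le_pos; [apply Rdiv_le_0_compat; lra | apply Rlt_le, exp_pos]. }
    replace ((exp (- d * B) - exp (- d * A)) / - d) with ((exp (- d * A) - exp (- d * B)) / d)
      by (field; lra).
    unfold Rdiv in *; lra.
Qed.

(* The improper integral over the whole line, along symmetric intervals; it is only used
   for integrands with exponential decay at both ends. *)
Definition lim_int (f : R -> R) (L : R) : Prop :=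
  is_lim_seq (fun n => RInt f (- INR n) (INR n)) L.

Lemma lim_int_unique (f : R -> R) (L L' : R) : lim_int f L -> lim_int f L' -> L = L'.
Proof.
  intros H H'. apply is_lim_seq_unique in H. apply is_lim_seq_unique in H'.
  rewrite H in H'. now injection H'.
Qed.

Lemma lim_int_ext (f g : R -> R) (L : R) : (forall s, f s = g s) -> lim_int f L -> lim_int g L.
Proof.
  intros E; apply is_lim_seq_ext; intros n; apply RInt_ext; auto.
Qed.

Lemma lim_int_plus (f g : R -> R) (L M : R) :
  (forall s, continuous f s) -> (forall s, continuous g s) ->
  lim_int f L -> lim_int g M -> lim_int (fun s => f s + g s) (L + M).
Proof.
  intros Hf Hg HL HM.
  apply (is_lim_seq_ext (fun n => RInt f (- INR n) (INR n) + RInt g (- INR n) (INR n))).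
  - intros n; now rewrite RInt_plus_cont.
  - now apply is_lim_seq_plus'.
Qed.

Lemma lim_int_scal (f : R -> R) (c L : R) :
  (forall s, continuous f s) -> lim_int f L -> lim_int (fun s => c * f s) (c * L).
Proof.
  intros Hf HL.
  apply (is_lim_seq_ext (fun n => c * RInt f (- INR n) (INR n))).
  - intros n; now rewrite RInt_scal_cont.
  - now apply (is_lim_seq_scal_l _ c L).
Qed.

Lemma lim_int_minus (f g : R -> R) (L M : R) :
  (forall s, continuous f s) -> (forall s, continuous g s) ->
  lim_int f L -> lim_int g M -> lim_int (fun s => f s - g s) (L - M).
Proof.
  intros Hf Hg HL HM.
  apply (is_lim_seq_ext (fun n => RInt f (- INR n) (INR n) - RInt g (- INR n) (INR n))).
  - intros n; now rewrite RInt_minus_cont.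
  - now apply is_lim_seq_minus'.
Qed.

Lemma lim_int_le (f g : R -> R) (L M : R) :
  (forall s, continuous f s) -> (forall s, continuous g s) -> (forall s, f s <= g s) ->
  lim_int f L -> lim_int g M -> L <= M.
Proof.
  intros Hf Hg Hfg HL HM.
  apply (is_lim_seq_le _ _ _ _) with (2 := HL) (3 := HM).
  intros n; apply RInt_le; auto using ex_RInt_cont.
  generalize (pos_INR n); lra.
Qed.

Lemma is_lim_seq_exp_neg (k : R) : 0 < k -> is_lim_seq (fun n => exp (- k * INR n)) 0.
Proof.
  intros Hk.
  apply (is_lim_comp_seq exp (fun n => - k * INR n) m_infty 0).
  - apply is_lim_exp_m.
  - exists 0%nat; discriminate.
  - replace m_infty with (Rbar_mult (- k) p_infty).
    + apply is_lim_seq_scal_l, is_lim_seq_INR.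
    + simpl; case Rle_dec; intros; [exfalso; lra | reflexivity].
Qed.

Lemma is_lim_seq_tail (a C d D : R) : 0 < a -> 0 < d ->
  is_lim_seq (fun n => C * exp (a * - INR n) + D * exp (- d * INR n)) 0.
Proof.
  intros Ha Hd.
  replace (Finite 0) with (Finite (C * 0 + D * 0)) by (f_equal; ring).
  apply is_lim_seq_plus'.
  - apply (is_lim_seq_scal_l _ C 0).
    apply is_lim_seq_ext with (2 := is_lim_seq_exp_neg a Ha).
    intros n; f_equal; ring.
  - apply (is_lim_seq_scal_l _ D 0), is_lim_seq_exp_neg, Hd.
Qed.

Lemma abs_RInt_diff (f : R -> R) (a C d D A B A' B' : R) : 0 < a -> 0 < d ->
  (forall s, continuous f s) ->
  (forall s, Rabs (f s) <= C * exp (a * s)) -> (forall s, Rabs (f s) <= D * exp (- d * s)) ->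
  A' <= A -> B <= B' ->
  Rabs (RInt f A B - RInt f A' B') <= C / a * exp (a * A) + D / d * exp (- d * B).
Proof.
  intros Ha Hd Hf HC HD HA HB.
  rewrite <- (RInt_Chasles_cont f A' A B') by auto.
  rewrite <- (RInt_Chasles_cont f A B B') by auto.
  generalize (abs_RInt_left f a C A' A Ha HA Hf HC) (abs_RInt_right f d D B B' Hd HB Hf HD).
  intros H1 H2.
  replace (_ - _) with (- (RInt f A' A + RInt f B B')) by ring.
  rewrite Rabs_Ropp.
  apply Rle_trans with (1 := Rabs_triang _ _); lra.
Qed.

Lemma lim_int_ex (f : R -> R) (a C d D : R) : 0 < a -> 0 < d ->
  (forall s, continuous f s) ->
  (forall s, Rabs (f s) <= C * exp (a * s)) -> (forall s, Rabs (f s) <= D * exp (- d * s)) ->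
  exists L, lim_int f L.
Proof.
  intros Ha Hd Hf HC HD.
  apply ex_lim_seq_cauchy_corr.
  intros eps.
  destruct (proj2 (is_lim_seq_spec _ _) (is_lim_seq_tail a (C / a) d (D / d) Ha Hd)
              (pos_div_2 eps)) as [N HN].
  exists N; intros n m Hn Hm; simpl in HN.
  specialize (HN N (le_n N)).
  assert (key : forall k, (N <= k)%nat ->
     Rabs (RInt f (- INR N) (INR N) - RInt f (- INR k) (INR k)) < eps / 2).
  { intros k Hk. apply le_INR in Hk.
    eapply Rle_lt_trans.
    - apply abs_RInt_diff with (a := a) (C := C) (d := d) (D := D); auto; lra.
    - revert HN; rewrite Rminus_0_r; intros HN.
      eapply Rle_lt_trans; [apply Rle_abs | exact HN]. }
  generalize (key n Hn) (key m Hm); intros H1 H2.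
  replace (_ - _) with
    ((RInt f (- INR N) (INR N) - RInt f (- INR m) (INR m)) -
     (RInt f (- INR N) (INR N) - RInt f (- INR n) (INR n))) by ring.
  eapply Rle_lt_trans; [apply Rabs_triang |].
  rewrite Rabs_Ropp; lra.
Qed.

(** Lets the outer interval grow in [abs_RInt_diff]. The cuts [A] and [B] are independent of one
    another, neither symmetric nor ordered, so that translated contours and substituted bounds can
    be compared with a limit defined along symmetric intervals. *)
Lemma lim_int_tail (f : R -> R) (a C d D L : R) : 0 < a -> 0 < d ->
  (forall s, continuous f s) ->
  (forall s, Rabs (f s) <= C * exp (a * s)) -> (forall s, Rabs (f s) <= D * exp (- d * s)) ->
  lim_int f L ->
  forall A B, Rabs (RInt f A B - L) <= C / a * exp (a * A) + D / d * exp (- d * B).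
Proof.
  intros Ha Hd Hf HC HD HL A B.
  assert (HL' : is_lim_seq (fun n => Rabs (RInt f A B - RInt f (- INR n) (INR n)))
                  (Rabs (RInt f A B - L))).
  { apply (is_lim_seq_abs _ (RInt f A B - L)).
    apply is_lim_seq_minus'; [apply is_lim_seq_const | exact HL]. }
  apply (is_lim_seq_le_loc _ _ _ (C / a * exp (a * A) + D / d * exp (- d * B)))
    with (2 := HL') (3 := is_lim_seq_const _).
  destruct (nfloor_ex (Rabs A + Rabs B)) as [N HN].
  { generalize (Rabs_pos A) (Rabs_pos B); lra. }
  exists (S N); intros n Hn.
  apply le_INR in Hn; rewrite S_INR in Hn.
  apply abs_RInt_diff; auto.
  - generalize (Rle_abs (- A)) (Rabs_pos B); rewrite Rabs_Ropp; lra.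
  - generalize (Rle_abs B) (Rabs_pos A); lra.
Qed.

Lemma lim_int_abs_le (f : R -> R) (a C d D L : R) : 0 < a -> 0 < d ->
  (forall s, continuous f s) ->
  (forall s, Rabs (f s) <= C * exp (a * s)) -> (forall s, Rabs (f s) <= D * exp (- d * s)) ->
  lim_int f L -> Rabs L <= C / a + D / d.
Proof.
  intros Ha Hd Hf HC HD HL.
  generalize (lim_int_tail f a C d D L Ha Hd Hf HC HD HL 0 0).
  rewrite RInt_point !Rmult_0_r exp_0 !Rmult_1_r.
  unfold zero; simpl; rewrite Rminus_0_l Rabs_Ropp; auto.
Qed.

Lemma continuous_exp_of {U : UniformSpace} (f : U -> R) (x : U) :
  continuous f x -> continuous (fun u => exp (f u)) x.
Proof. intros H; apply (continuous_comp f exp); [auto | apply continuous_exp]. Qed.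

Lemma continuous_sin_of {U : UniformSpace} (f : U -> R) (x : U) :
  continuous f x -> continuous (fun u => sin (f u)) x.
Proof. intros H; apply (continuous_comp f sin); [auto | apply continuous_sin]. Qed.

Lemma continuous_cos_of {U : UniformSpace} (f : U -> R) (x : U) :
  continuous f x -> continuous (fun u => cos (f u)) x.
Proof. intros H; apply (continuous_comp f cos); [auto | apply continuous_cos]. Qed.

Ltac smooth2 := intros [? ?]; simpl;
  repeat first
    [ apply: continuous_const | apply: continuous_fst | apply: continuous_snd
    | apply: continuous_plus | apply: continuous_minus | apply: continuous_mult
    | apply: continuous_opp | apply: continuous_exp_of
    | apply: continuous_sin_of | apply: continuous_cos_of ].

(** * Integrals depending on a parameter *)

Definition continuous2 (D : R -> R -> R) : Prop :=
  forall z : R * R, continuous (fun z => D (fst z) (snd z)) z.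

Lemma continuous2_r (D : R -> R -> R) (x s : R) : continuous2 D -> continuous (fun s => D x s) s.
Proof.
  intros HD.
  apply (continuous_comp_2 (fun _ : R => x) (fun s : R => s) D).
  - apply continuous_const.
  - apply continuous_id.
  - apply (HD (x, s)).
Qed.

Lemma continuous2_l (D : R -> R -> R) (x s : R) : continuous2 D -> continuous (fun x => D x s) x.
Proof.
  intros HD.
  apply (continuous_comp_2 (fun x : R => x) (fun _ : R => s) D).
  - apply continuous_id.
  - apply continuous_const.
  - apply (HD (x, s)).
Qed.

Lemma continuous2_swap (D : R -> R -> R) : continuous2 D -> continuous2 (fun x y => D y x).
Proof.
  intros HD [x y].
  apply (continuous_comp_2 (@snd R R) (@fst R R) D).
  - apply continuous_snd.
  - apply continuous_fst.
  - apply (HD (y, x)).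
Qed.

Lemma continuous2_pt (D : R -> R -> R) (x y : R) : continuous2 D -> continuity_2d_pt D x y.
Proof. intros HD; apply continuity_2d_pt_filterlim; apply (HD (x, y)). Qed.

(** Under the integral sign the derivative in [th] is also a derivative in [s], so only the boundary
    values of [Q] survive. It serves both for moving contours, where the hypotheses are a
    Cauchy-Riemann equation, and for Fubini. *)
Lemma is_derive_RInt_of_derive (P Q D : R -> R -> R) (A B th : R) :
  (forall th s, is_derive (fun th => P th s) th (D th s)) ->
  (forall th s, is_derive (fun s => Q th s) s (D th s)) ->
  (forall th s, continuous (fun s => P th s) s) -> continuous2 D ->
  is_derive (fun th => RInt (fun s => P th s) A B) th (Q th B - Q th A).
Proof.
  intros HP HQ HPc HD.
  replace (Q th B - Q th A) with (RInt (fun s => Derive (fun th => P th s) th) A B).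
  - apply is_derive_RInt_param.
    + apply filter_forall; intros; eexists; apply HP.
    + intros t _.
      apply continuity_2d_pt_ext with (f := D).
      * intros; symmetry; apply is_derive_unique, HP.
      * now apply continuous2_pt.
    + apply filter_forall; intros; now apply ex_RInt_cont.
  - rewrite <- (RInt_of_derive (fun s => Q th s) (fun s => D th s)); auto.
    + apply RInt_ext; intros; apply is_derive_unique, HP.
    + intros; now apply continuous2_r.
Qed.

Lemma continuous_RInt_param (K : R -> R -> R) (a b s : R) : a <= b -> continuous2 K ->
  continuous (fun s => RInt (fun y => K s y) a b) s.
Proof.
  intros Hab HK.
  apply filterlim_locally; intros eps.
  assert (He : 0 < eps / (b - a + 1)).
  { apply Rdiv_lt_0_compat; [apply eps | lra]. }
  destruct (uniform_continuity_2d_1d (fun y s => K s y) a b s) with (eps := mkposreal _ He)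
    as [del Hdel].
  { intros; apply continuous2_pt, continuous2_swap, HK. }
  exists del; intros s' Hs'.
  unfold ball in *; simpl in *; unfold AbsRing_ball, abs, minus, plus, opp in *; simpl in *.
  apply Rabs_lt_between in Hs'.
  replace (_ + _) with (RInt (fun y => K s' y - K s y) a b).
  - eapply Rle_lt_trans.
    + apply abs_RInt_le_const with (M := eps / (b - a + 1)); auto.
      * apply ex_RInt_cont; intros; apply: continuous_minus; now apply continuous2_r.
      * intros y Hy; apply Rlt_le.
        apply (Hdel y s y s'); try split; destruct del as [del Hd]; simpl in *; try lra.
        rewrite Rminus_diag Rabs_R0; auto.
    + apply Rlt_le_trans with ((b - a + 1) * (eps / (b - a + 1))).
      * apply Rmult_lt_compat_r; auto; lra.
      * right; field; lra.
  - apply RInt_minus_cont; intros; now apply continuous2_r.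
Qed.

Lemma eq_of_derive_eq (F G f : R -> R) (A B : R) :
  (forall s, is_derive F s (f s)) -> (forall s, is_derive G s (f s)) ->
  F A = G A -> F B = G B.
Proof.
  intros HF HG HA.
  destruct (MVT_gen (fun s => F s - G s) A B (fun s => 0)) as [c [_ Hc]].
  - intros x _.
    replace 0 with (f x - f x) by ring.
    apply: is_derive_minus; auto.
  - intros x _; apply continuity_pt_filterlim.
    apply (ex_derive_continuous (fun s => F s - G s)).
    apply: ex_derive_minus; eexists; eauto.
  - lra.
Qed.

(** As functions of the upper bound [B], both sides vanish at [B = A] and have the same
    derivative. *)
Lemma RInt_Fubini (K : R -> R -> R) (a b A B : R) : a <= b -> continuous2 K ->
  RInt (fun y => RInt (fun s => K s y) A B) a b = RInt (fun s => RInt (fun y => K s y) a b) A B.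
Proof.
  intros Hab HK.
  assert (Hin : forall s y, is_derive (fun y => RInt (fun y => K s y) a y) y (K s y)).
  { intros s y; apply: is_derive_RInt.
    - apply filter_forall; intros; apply: RInt_correct; apply ex_RInt_cont; intros.
      now apply continuous2_r.
    - now apply continuous2_r. }
  assert (Hder : forall B y, is_derive (fun B => RInt (fun s => K s y) A B) B (K B y)).
  { intros B' y; apply: (is_derive_RInt (fun s => K s y)).
    - apply filter_forall; intros; apply: RInt_correct; apply ex_RInt_cont; intros.
      now apply (continuous2_l K).
    - now apply (continuous2_l K). }
  assert (Hc : forall s, continuous (fun s => RInt (fun y => K s y) a b) s).
  { intros; now apply continuous_RInt_param. }
  apply (eq_of_derive_eq (fun B => RInt (fun y => RInt (fun s => K s y) A B) a b)
           (fun B => RInt (fun s => RInt (fun y => K s y) a b) A B)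
           (fun s => RInt (fun y => K s y) a b) A B).
  - intros s.
    replace (RInt (fun y => K s y) a b)
      with (RInt (fun y => K s y) a b - RInt (fun y => K s y) a a).
    + apply (is_derive_RInt_of_derive (fun B y => RInt (fun s => K s y) A B)
               (fun s y => RInt (fun y => K s y) a y) K a b s); auto.
      intros th y.
      destruct (Rle_dec A th) as [H|H].
      * apply (continuous_RInt_param (fun y s => K s y) A th y); auto.
        now apply continuous2_swap.
      * apply continuous_ext with (f := fun y => opp (RInt (fun s => K s y) th A)).
        { intros z; apply: opp_RInt_swap; apply ex_RInt_cont; intros.
          now apply (continuous2_l K). }
        apply: continuous_opp.
        apply (continuous_RInt_param (fun y s => K s y) th A y); [lra |].
        now apply continuous2_swap.
    + rewrite RInt_point; unfold zero; simpl; ring.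
  - intros s; apply (is_derive_RInt (fun s => RInt (fun y => K s y) a b) _ A s); auto.
    apply filter_forall; intros; apply: RInt_correct; now apply ex_RInt_cont.
  - rewrite RInt_point.
    rewrite (RInt_ext _ (fun _ => 0)).
    + rewrite RInt_const; unfold scal; simpl; unfold mult; simpl; unfold zero; simpl; ring.
    + intros; apply: RInt_point.
Qed.

(* Moving the contour of integration: [d/dth P = d/ds Q] is the form taken by Cauchy's theorem
   for the integral of a holomorphic function over a moving line. *)
Lemma lim_int_shift (P Q D : R -> R -> R) (a C d E th0 th1 L : R) : 0 < a -> 0 < d ->
  (forall th s, is_derive (fun th => P th s) th (D th s)) ->
  (forall th s, is_derive (fun s => Q th s) s (D th s)) ->
  (forall th s, continuous (fun s => P th s) s) -> continuous2 D ->
  (forall th s, Rmin th0 th1 <= th <= Rmax th0 th1 -> Rabs (Q th s) <= C * exp (a * s)) ->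
  (forall th s, Rmin th0 th1 <= th <= Rmax th0 th1 -> Rabs (Q th s) <= E * exp (- d * s)) ->
  lim_int (P th0) L -> lim_int (P th1) L.
Proof.
  intros Ha Hd HP HQ HPc HD HC HE HL.
  unfold lim_int.
  apply is_lim_seq_ext with (u := fun n => RInt (P th0) (- INR n) (INR n) +
     (RInt (P th1) (- INR n) (INR n) - RInt (P th0) (- INR n) (INR n))).
  { intros; ring. }
  replace (Finite L) with (Finite (L + 0)) by (f_equal; ring).
  apply is_lim_seq_plus'; auto.
  apply is_lim_seq_abs_0.
  apply is_lim_seq_le_le with (u := fun _ => 0)
    (w := fun n => Rabs (th1 - th0) * (C * exp (a * - INR n) + E * exp (- d * INR n))).
  - intros n; split; [apply Rabs_pos |].
    (* By the mean value theorem in the angle, the two truncated integrals differ by [th1 - th0]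
       times the boundary terms of [Q] at an intermediate angle; the bounds on [Q], uniform in the
       angle, make these vanish. *)
    destruct (MVT_gen (fun th => RInt (P th) (- INR n) (INR n)) th0 th1
                (fun th => Q th (INR n) - Q th (- INR n))) as [c [Hc Eq]].
    + intros x _; now apply (is_derive_RInt_of_derive P Q D).
    + intros x _; apply continuity_pt_filterlim.
      apply (ex_derive_continuous (fun th => RInt (P th) (- INR n) (INR n))).
      eexists; now apply (is_derive_RInt_of_derive P Q D).
    + rewrite Eq Rabs_mult Rmult_comm.
      apply Rmult_le_compat_l; [apply Rabs_pos |].
      generalize (HC c (- INR n) Hc) (HE c (INR n) Hc); intros H1 H2.
      eapply Rle_trans; [apply Rabs_triang |].
      rewrite Rabs_Ropp; lra.
  - apply is_lim_seq_const.
  - replace (Finite 0) with (Finite (Rabs (th1 - th0) * 0)) by (f_equal; ring).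
    apply (is_lim_seq_scal_l _ _ 0).
    now apply is_lim_seq_tail.
Qed.

(** * Euler's integral *)

Lemma exp_ge_tangent (x : R) : 1 + x <= exp x.
Proof.
  destruct (Req_dec x 0) as [->|Hx].
  - rewrite exp_0; lra.
  - now apply Rlt_le, exp_ineq1.
Qed.

Lemma exp_le (x y : R) : x <= y -> exp x <= exp y.
Proof. intros [H| ->]; [now apply Rlt_le, exp_increasing | lra]. Qed.

(* [k s - c e^s] is maximal where [c e^s = k]. *)
Lemma exp_sub_exp_le (k c s : R) : 0 < k -> 0 < c ->
  exp (k * s - c * exp s) <= exp (k * ln (k / c) - k).
Proof.
  intros Hk Hc.
  assert (Hkc : 0 < k / c) by now apply Rdiv_lt_0_compat.
  assert (H := exp_ge_tangent (s - ln (k / c))).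
  replace (exp (s - ln (k / c))) with (c / k * exp s) in H.
  - assert (H' : k * (1 + (s - ln (k / c))) <= c * exp s).
    { replace (c * exp s) with (k * (c / k * exp s)) by (field; lra).
      apply Rmult_le_compat_l; lra. }
    apply exp_le; lra.
  - unfold Rminus; rewrite exp_plus exp_Ropp exp_ln; auto.
    field; lra.
Qed.

Lemma abs_exp_mul_le (u v w : R) : Rabs v <= 1 -> u <= w -> Rabs (exp u * v) <= exp w.
Proof.
  intros Hv Huw.
  rewrite Rabs_mult (Rabs_pos_eq (exp u)); [| apply Rlt_le, exp_pos].
  apply Rle_trans with (exp u * 1).
  - apply Rmult_le_compat_l; auto; apply Rlt_le, exp_pos.
  - rewrite Rmult_1_r; now apply exp_le.
Qed.

Lemma abs_sin_le_1 (x : R) : Rabs (sin x) <= 1.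
Proof. apply Rabs_le, SIN_bound. Qed.

Lemma abs_cos_le_1 (x : R) : Rabs (cos x) <= 1.
Proof. apply Rabs_le, COS_bound. Qed.

Lemma damped_le_left (a c e s v : R) : c <= e -> 0 <= c -> Rabs v <= 1 ->
  Rabs (exp (a * s - e * exp s) * v) <= 1 * exp (a * s).
Proof.
  intros Hce Hc Hv; rewrite Rmult_1_l; apply abs_exp_mul_le; auto.
  generalize (Rmult_le_pos e (exp s)) (exp_pos s); lra.
Qed.

(** One power is borrowed: [a s = (a + 1) s - s], where [exp ((a + 1) s - c e^s)] is bounded by its
    maximum and [exp (- s)] is the decay. The constant involves the lower bound [c] instead of [e],
    so it stays the same while a ray turns. *)
Lemma damped_le_right (a c e s v : R) : 0 < a -> c <= e -> 0 < c -> Rabs v <= 1 ->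
  Rabs (exp (a * s - e * exp s) * v)
    <= exp ((a + 1) * ln ((a + 1) / c) - (a + 1)) * exp (- 1 * s).
Proof.
  intros Ha Hce Hc Hv.
  apply Rle_trans with (exp (a * s - c * exp s)).
  - apply abs_exp_mul_le; auto.
    generalize (Rmult_le_compat_r (exp s) c e) (exp_pos s); lra.
  - replace (a * s - c * exp s) with (((a + 1) * s - c * exp s) + - 1 * s) by ring.
    rewrite exp_plus; apply Rmult_le_compat_r; [apply Rlt_le, exp_pos |].
    apply exp_sub_exp_le; lra.
Qed.

(** Euler's [Gamma (a)] after the substitution [t = e^s]. It is linked to [rgamma] only later,
    through Gauss' limit. *)
Definition gam (a : R) : R :=
  real (Lim_seq (fun n => RInt (fun s => exp (a * s - exp s)) (- INR n) (INR n))).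

Lemma lim_int_gam (a : R) : 0 < a -> lim_int (fun s => exp (a * s - exp s)) (gam a).
Proof.
  intros Ha.
  destruct (lim_int_ex (fun s => exp (a * s - exp s)) a 1 1
     (exp ((a + 1) * ln ((a + 1) / 1) - (a + 1)))) as [L HL]; auto; try lra.
  - smooth.
  - intros s; replace (exp (a * s - exp s)) with (exp (a * s - 1 * exp s) * 1)
      by (rewrite Rmult_1_r Rmult_1_l; auto).
    apply (damped_le_left a 1 1); rewrite ?Rabs_R1; lra.
  - intros s; replace (exp (a * s - exp s)) with (exp (a * s - 1 * exp s) * 1)
      by (rewrite Rmult_1_r Rmult_1_l; auto).
    apply (damped_le_right a 1 1); rewrite ?Rabs_R1; lra.
  - replace (gam a) with L; auto.
    unfold gam; apply is_lim_seq_unique in HL; now rewrite HL.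
Qed.

Lemma lim_int_derive (F f : R -> R) : (forall s, is_derive F s (f s)) ->
  (forall s, continuous f s) ->
  forall l l' : R, is_lim_seq (fun n => F (INR n)) l -> is_lim_seq (fun n => F (- INR n)) l' ->
  lim_int f (l - l').
Proof.
  intros HF Hf l l' Hl Hl'.
  apply is_lim_seq_ext with (u := fun n => F (INR n) - F (- INR n)).
  - intros n; symmetry; now apply RInt_of_derive.
  - now apply is_lim_seq_minus'.
Qed.

Lemma gam_succ (a : R) : 0 < a -> gam (a + 1) = a * gam a.
Proof.
  intros Ha.
  assert (H : lim_int (fun s => a * exp (a * s - exp s) - exp ((a + 1) * s - exp s)) (0 - 0)).
  { apply (lim_int_derive (fun s => exp (a * s - exp s))).
    - intros s; auto_derive; auto.
      replace ((a + 1) * s - exp s) with ((a * s - exp s) + s) by ring.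
      rewrite (exp_plus (a * s - exp s) s); unfold Rminus; ring.
    - smooth.
    - apply is_lim_seq_le_le with (u := fun _ => 0)
        (w := fun n => exp ((a + 1) * ln ((a + 1) / 1) - (a + 1)) * exp (- 1 * INR n)).
      + intros n; split; [apply Rlt_le, exp_pos |].
        generalize (damped_le_right a 1 1 (INR n) 1); rewrite Rabs_R1 Rmult_1_r Rmult_1_l.
        intros H; eapply Rle_trans; [apply Rle_abs | apply H]; lra.
      + apply is_lim_seq_const.
      + replace (Finite 0) with
          (Finite (exp ((a + 1) * ln ((a + 1) / 1) - (a + 1)) * 0)) by (f_equal; ring).
        apply (is_lim_seq_scal_l _ _ 0), (is_lim_seq_exp_neg 1); lra.
    - apply is_lim_seq_le_le with (u := fun _ => 0) (w := fun n => exp (- a * INR n)).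
      + intros n; split; [apply Rlt_le, exp_pos |].
        apply exp_le; generalize (exp_pos (- INR n)); lra.
      + apply is_lim_seq_const.
      + now apply is_lim_seq_exp_neg. }
  assert (H' : lim_int (fun s => a * exp (a * s - exp s) - exp ((a + 1) * s - exp s))
                 (a * gam a - gam (a + 1))).
  { apply lim_int_minus; try smooth.
    - apply lim_int_scal; [smooth | now apply lim_int_gam].
    - apply lim_int_gam; lra. }
  generalize (lim_int_unique _ _ _ H H'); lra.
Qed.

Lemma gam_1 : gam 1 = 1.
Proof.
  apply (lim_int_unique (fun s => exp (1 * s - exp s))).
  - apply lim_int_gam; lra.
  - assert (E : - 0 - - exp (- 0) = 1) by (rewrite Ropp_0 exp_0; ring).
    apply (eq_ind _ (lim_int _)) with (2 := E); clear E.
    apply (lim_int_derive (fun s => - exp (- exp s))).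
    + intros s; auto_derive; auto.
      replace (1 * s - exp s) with (s + - exp s) by ring; rewrite exp_plus; ring.
    + smooth.
    + apply (is_lim_seq_opp _ 0).
      apply is_lim_seq_le_le with (u := fun _ => 0) (w := fun n => exp (- 1 * INR n)).
      * intros n; split; [apply Rlt_le, exp_pos |].
        apply exp_le; generalize (exp_ge_tangent (INR n)); lra.
      * apply is_lim_seq_const.
      * apply (is_lim_seq_exp_neg 1); lra.
    + apply (is_lim_seq_opp _ (exp (- 0))).
      apply (is_lim_seq_continuous exp (fun n => - exp (- INR n)) (- 0)).
      * apply continuity_pt_filterlim, continuous_exp.
      * apply (is_lim_seq_opp _ 0).
        apply is_lim_seq_ext with (u := fun n => exp (- 1 * INR n)).
        { intros n; f_equal; ring. }
        apply (is_lim_seq_exp_neg 1); lra.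
Qed.

Lemma gam_pos (a : R) : 0 < a -> 0 < gam a.
Proof.
  intros Ha.
  assert (H : forall b, 1 <= b -> 0 < gam b).
  { intros b Hb.
    apply Rlt_le_trans with (RInt (fun s => exp (b * s - exp s)) 0 1).
    - apply RInt_gt_0; [lra | intros; apply exp_pos | smooth].
    - assert (L := lim_int_gam b ltac:(lra)).
      apply (is_lim_seq_le_loc _ _ _ _) with (2 := is_lim_seq_const _) (3 := L).
      exists 1%nat; intros n Hn; apply le_INR in Hn; simpl in Hn.
      assert (Hc : forall s, continuous (fun s => exp (b * s - exp s)) s) by smooth.
      rewrite <- (RInt_Chasles_cont _ (- INR n) 0 (INR n)) by auto.
      rewrite <- (RInt_Chasles_cont _ 0 1 (INR n)) by auto.
      assert (P : forall u v, u <= v -> 0 <= RInt (fun s => exp (b * s - exp s)) u v).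
      { intros u v Huv; apply RInt_ge_0; auto using ex_RInt_cont.
        intros; apply Rlt_le, exp_pos. }
      generalize (P (- INR n) 0 ltac:(lra)) (P 1 (INR n) ltac:(lra)); lra. }
  apply Rmult_lt_reg_l with a; auto.
  rewrite Rmult_0_r -gam_succ; auto; apply H; lra.
Qed.

Lemma gam_fact (n : nat) : gam (INR n + 1) = INR (Factorial.fact n).
Proof.
  induction n as [|n IH].
  - simpl; rewrite Rplus_0_l; apply gam_1.
  - rewrite gam_succ; [| apply lt_0_INR; lia].
    rewrite S_INR IH.
    replace (Factorial.fact (S n)) with (S n * Factorial.fact n)%nat by reflexivity.
    rewrite mult_INR S_INR; ring.
Qed.

Lemma gam_rising (a : R) (n : nat) : 0 < a -> gam (a + INR n) = rising a n * gam a.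
Proof.
  intros Ha; induction n as [|n IH].
  - simpl; rewrite Rplus_0_r; ring.
  - rewrite S_INR -Rplus_assoc gam_succ; [| generalize (pos_INR n); lra].
    rewrite IH; simpl; ring.
Qed.

Lemma cos_le_between (th0 th : R) : - (PI / 2) < th0 < PI / 2 ->
  Rmin 0 th0 <= th <= Rmax 0 th0 -> cos th0 <= cos th.
Proof.
  intros H; generalize PI_RGT_0; intros HP.
  unfold Rmin, Rmax; case Rle_dec; intros H0 Hth.
  - apply cos_decr_1; lra.
  - rewrite -(cos_neg th0) -(cos_neg th); apply cos_decr_1; lra.
Qed.

(* Euler's integral of [Gamma] along the ray of argument [th]; the phase [al] makes the real
   statement carry both the real and the imaginary part. *)
Lemma lim_int_gam_ray (a th al : R) : 0 < a -> - (PI / 2) < th < PI / 2 ->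
  lim_int (fun s => exp (a * s - cos th * exp s) * sin (al + a * th - sin th * exp s))
    (sin al * gam a).
Proof.
  intros Ha Hth.
  assert (Hc : 0 < cos th) by (apply cos_gt_0; lra).
  (* With [F (zeta) = e^{i al} exp (a zeta - e^zeta)] at [zeta = s + i th], the three functions are
     [Im F], [Re F] and [Re F']: Cauchy-Riemann reads [d/dth Im F = d/ds Re F]. *)
  apply (lim_int_shift
    (fun th s => exp (a * s - cos th * exp s) * sin (al + a * th - sin th * exp s))
    (fun th s => exp (a * s - cos th * exp s) * cos (al + a * th - sin th * exp s))
    (fun th s => exp (a * s - cos th * exp s) *
       (sin th * exp s * sin (al + a * th - sin th * exp s)
        + (a - cos th * exp s) * cos (al + a * th - sin th * exp s)))
    a 1 1 (exp ((a + 1) * ln ((a + 1) / cos th) - (a + 1))) 0 th); auto; try lra.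
  - intros t s; auto_derive; auto; unfold Rminus; ring.
  - intros t s; auto_derive; auto; unfold Rminus; ring.
  - smooth.
  - smooth2.
  - intros t s Ht; apply (damped_le_left a (cos th)); try lra.
    + now apply cos_le_between.
    + apply abs_cos_le_1.
  - intros t s Ht; apply (damped_le_right a (cos th)); try lra.
    + now apply cos_le_between.
    + apply abs_cos_le_1.
  - apply lim_int_ext with (f := fun s => sin al * exp (a * s - exp s)).
    + intros s; rewrite cos_0 sin_0 Rmult_1_l Rmult_0_r Rmult_0_l Rplus_0_r Rminus_0_r; ring.
    + apply lim_int_scal; [smooth | now apply lim_int_gam].
Qed.

(** * The sine product and the reflection formula *)

(** Cauchy's integral, equal to [pi k! / (2^{k+1} Gamma (1 + k/2 + z) Gamma (1 + k/2 - z))]; only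
    its recurrence in [k] is used below, in the manner of Wallis. *)
Definition cos_moment (k : nat) (z : R) : R :=
  RInt (fun x => cos x ^ k * cos (2 * z * x)) 0 (PI / 2).

(** Two integrations by parts, merged into a single antiderivative that vanishes at [0] through its
    sines and at [pi / 2] through its cosines. *)
Lemma cos_moment_rec (k : nat) (z : R) :
  (INR (k + 2) ^ 2 - 4 * z ^ 2) * cos_moment (k + 2) z
    = INR (k + 2) * INR (k + 1) * cos_moment k z.
Proof.
  assert (H : RInt (fun x => (4 * z ^ 2 - INR (k + 2) ^ 2) * (cos x ^ (k + 2) * cos (2 * z * x))
                + INR (k + 2) * INR (k + 1) * (cos x ^ k * cos (2 * z * x))) 0 (PI / 2) = 0).
  { etransitivity; [apply (RInt_of_derive
      (fun x => 2 * z * cos x ^ S (S k) * sin (2 * z * x)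
                - INR (S (S k)) * (cos x ^ S k * sin x * cos (2 * z * x)))) |].
    - intros x.
      replace (k + 2)%nat with (S (S k)) by lia; replace (k + 1)%nat with (S k) by lia.
      auto_derive; auto.
      assert (Hs := sin2_cos2 x); unfold Rsqr in Hs.
      set (w := cos (2 * z * x)); set (v := sin (2 * z * x)).
      change (Nat.pred (S (S k))) with (S k); change (Nat.pred (S k)) with k.
      change (match k with 0%nat => 1 | S _ => INR k + 1 end) with (INR (S k)).
      rewrite !S_INR; simpl pow.
      match goal with |- ?l = ?r =>
        transitivity (r + (INR k + 1 + 1) * (INR k + 1) * cos x ^ k * w
                          * (sin x * sin x + cos x * cos x - 1)) end.
      + ring.
      + rewrite Hs; ring.
    - smooth.
    - rewrite cos_PI2 cos_0 Rmult_0_r sin_0 !pow_i; [ | lia | lia]; toR; ring. }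
  rewrite RInt_plus_cont in H; [| smooth | smooth].
  rewrite !RInt_scal_cont in H; [| smooth | smooth].
  unfold cos_moment; lra.
Qed.

Lemma cos_moment_pos (k : nat) : 0 < cos_moment k 0.
Proof.
  generalize PI_RGT_0; intros HP.
  apply RInt_gt_0; [lra | | smooth].
  intros x Hx; rewrite Rmult_0_r Rmult_0_l cos_0 Rmult_1_r.
  apply pow_lt, cos_gt_0; lra.
Qed.

Lemma mul_cos_le_sin (x : R) : 0 <= x <= PI / 2 -> x * cos x <= sin x.
Proof.
  intros Hx.
  destruct (MVT_gen (fun x => sin x - x * cos x) 0 x (fun x => x * sin x)) as [c [Hc E]].
  - intros y _; auto_derive; auto; ring.
  - intros y _; apply continuity_pt_filterlim.
    apply (ex_derive_continuous (fun x => sin x - x * cos x)); auto_derive; auto.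
  - rewrite Rmin_left in Hc; [| lra]; rewrite Rmax_right in Hc; [| lra].
    rewrite sin_0 in E.
    assert (0 <= c * sin c * (x - 0)); [| lra].
    repeat apply Rmult_le_pos; try lra.
    apply sin_ge_0; lra.
Qed.

Lemma one_sub_cos_le (u : R) : 0 <= 1 - cos u <= u ^ 2 / 2.
Proof.
  split; [generalize (COS_bound u); lra |].
  replace u with (2 * (u / 2)) at 1 by field.
  rewrite cos_2a_sin.
  assert (H : Rabs (sin (u / 2)) <= Rabs (u / 2)).
  { destruct (MVT_gen sin 0 (u / 2) cos) as [c [_ E]].
    - intros; apply is_derive_Reals, derivable_pt_lim_sin.
    - intros; apply continuity_pt_filterlim, continuous_sin.
    - rewrite sin_0 !Rminus_0_r in E; rewrite E Rabs_mult.
      generalize (abs_cos_le_1 c) (Rabs_pos (u / 2)); nra. }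
  apply Rsqr_le_abs_1 in H; unfold Rsqr in H; lra.
Qed.

(** In [cos^{k+2} x (1 - cos (2 z x))] the second factor is at most [2 z^2 x^2], and two of the
    cosines absorb [x^2] because [x cos x <= sin x]. What is left, [cos^k x sin^2 x], is a
    difference of consecutive moments at [0], which the recurrence makes small relative to the
    moment itself. *)
Lemma cos_moment_near (k : nat) (z : R) :
  Rabs (cos_moment (k + 2) 0 - cos_moment (k + 2) z)
    <= 2 * z ^ 2 * (cos_moment k 0 - cos_moment (k + 2) 0).
Proof.
  generalize PI_RGT_0; intros HP.
  unfold cos_moment.
  rewrite <- !RInt_minus_cont by smooth.
  rewrite <- RInt_scal_cont by smooth.
  apply (norm_RInt_le
    (fun x => cos x ^ (k + 2) * cos (2 * 0 * x) - cos x ^ (k + 2) * cos (2 * z * x))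
    (fun x => 2 * z ^ 2 * (cos x ^ k * cos (2 * 0 * x) - cos x ^ (k + 2) * cos (2 * 0 * x)))
    0 (PI / 2)).
  - lra.
  - intros x Hx; change (Rabs (cos x ^ (k + 2) * cos (2 * 0 * x) - cos x ^ (k + 2) * cos (2 * z * x))
      <= 2 * z ^ 2 * (cos x ^ k * cos (2 * 0 * x) - cos x ^ (k + 2) * cos (2 * 0 * x))).
    rewrite Rmult_0_r Rmult_0_l cos_0 !Rmult_1_r pow_add.
    assert (Hc : 0 <= cos x) by (apply cos_ge_0; lra).
    assert (Hk : 0 <= cos x ^ k) by now apply pow_le.
    destruct (one_sub_cos_le (2 * z * x)) as [H1 H2].
    replace (cos x ^ k * cos x ^ 2 - _) with (cos x ^ k * (cos x ^ 2 * (1 - cos (2 * z * x)))) by ring.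
    rewrite Rabs_pos_eq; [| repeat apply Rmult_le_pos; auto; lra].
    replace (2 * z ^ 2 * _) with (cos x ^ k * (2 * z ^ 2 * (1 - cos x ^ 2))) by ring.
    apply Rmult_le_compat_l; auto.
    assert (H3 := mul_cos_le_sin x Hx).
    assert (H4 : (x * cos x) ^ 2 <= sin x ^ 2) by (apply pow_incr; split; auto; apply Rmult_le_pos; lra).
    assert (H5 := sin2_cos2 x); unfold Rsqr in H5.
    apply Rle_trans with (cos x ^ 2 * ((2 * z * x) ^ 2 / 2)).
    + apply Rmult_le_compat_l; auto using pow_le.
    + replace (1 - cos x ^ 2) with (sin x ^ 2) by (simpl; lra).
      replace (cos x ^ 2 * ((2 * z * x) ^ 2 / 2)) with (2 * z ^ 2 * (x * cos x) ^ 2) by field.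
      apply Rmult_le_compat_l; auto; generalize (pow2_ge_0 z); lra.
  - apply: RInt_correct; apply ex_RInt_cont; smooth.
  - apply: RInt_correct; apply ex_RInt_cont; smooth.
Qed.

Fixpoint sine_product (z : R) (n : nat) : R :=
  match n with
  | O => 1
  | S m => sine_product z m * (1 - z ^ 2 / INR (S m) ^ 2)
  end.

(** The left side does not depend on [n]: the recurrence at [z] divided by the one at [0] produces
    exactly the factor [1 - z^2 / (n + 1)^2]. The value is read off at [n = 0], where the moments
    are elementary. *)
Lemma sine_product_moment (z : R) (n : nat) : z <> 0 ->
  sine_product z n * (cos_moment (2 * n) z / cos_moment (2 * n) 0) = sin (PI * z) / (PI * z).
Proof.
  intros Hz; generalize PI_RGT_0; intros HP.
  induction n as [|n IH].
  - simpl sine_product; rewrite Rmult_1_l; simpl Nat.mul.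
    assert (H1 : cos_moment 0 z = sin (PI * z) / (2 * z)).
    { unfold cos_moment.
      etransitivity; [apply (RInt_of_derive (fun x => sin (2 * z * x) / (2 * z))) |].
      - intros x; auto_derive; auto; simpl; field; auto.
      - smooth.
      - rewrite Rmult_0_r sin_0; replace (2 * z * (PI / 2)) with (PI * z) by field.
        toR; field; auto. }
    assert (H2 : cos_moment 0 0 = PI / 2).
    { unfold cos_moment.
      etransitivity; [apply (RInt_of_derive (fun x => x)) |].
      - intros x; rewrite Rmult_0_r Rmult_0_l cos_0; simpl; auto_derive; auto; ring.
      - smooth.
      - toR; ring. }
    rewrite H1 H2; field; split; lra.
  - rewrite -IH; simpl sine_product.
    assert (Hr := cos_moment_rec (2 * n) z).
    assert (Hr0 := cos_moment_rec (2 * n) 0).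
    assert (Hp0 := cos_moment_pos (2 * n)).
    assert (Hp2 := cos_moment_pos (2 * n + 2)).
    replace (2 * S n)%nat with (2 * n + 2)%nat by lia.
    assert (HN : 0 < INR (S n)) by (apply lt_0_INR; lia).
    assert (E2 : INR (2 * n + 2) = 2 * INR (S n)) by (replace (2 * n + 2)%nat with (2 * S n)%nat by lia;
      rewrite mult_INR; f_equal; simpl; lra).
    assert (E1 : 0 < INR (2 * n + 1)) by (apply lt_0_INR; lia).
    change (match n with 0%nat => 1 | S _ => INR n + 1 end) with (INR (S n)).
    rewrite E2 in Hr Hr0.
    set (N := INR (S n)) in *; set (M := INR (2 * n + 1)) in *.
    set (A := cos_moment (2 * n + 2) z) in *; set (A0 := cos_moment (2 * n + 2) 0) in *.
    set (B := cos_moment (2 * n) z) in *; set (B0 := cos_moment (2 * n) 0) in *.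
    assert (HB : B = ((2 * N) ^ 2 - 4 * z ^ 2) * A / (2 * N * M)) by (rewrite Hr; field; lra).
    assert (HB0 : B0 = ((2 * N) ^ 2) * A0 / (2 * N * M)).
    { replace ((2 * N) ^ 2 * A0) with (((2 * N) ^ 2 - 4 * 0 ^ 2) * A0) by ring.
      rewrite Hr0; field; lra. }
    rewrite HB HB0; field; repeat split; lra.
Qed.

(** High powers of the cosine concentrate at [x = 0], where [cos (2 z x)] is [1]; hence the moment
    ratio tends to [1], within [2 z^2 / n] by [cos_moment_near]. *)
Lemma sine_product_lim (z : R) : z <> 0 ->
  is_lim_seq (sine_product z) (sin (PI * z) / (PI * z)).
Proof.
  intros Hz.
  assert (HR : is_lim_seq (fun n => cos_moment (2 * n) z / cos_moment (2 * n) 0) 1).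
  { apply is_lim_seq_incr_1.
    apply is_lim_seq_ext with (u := fun n => 1 -
      (1 - cos_moment (2 * S n) z / cos_moment (2 * S n) 0)); [intros; ring |].
    replace (Finite 1) with (Finite (1 - 0)) by (f_equal; ring).
    apply is_lim_seq_minus'; [apply is_lim_seq_const |].
    apply is_lim_seq_abs_0.
    apply is_lim_seq_le_le with (u := fun _ => 0) (w := fun n => 2 * z ^ 2 * / INR (S n)).
    - intros n; split; [apply Rabs_pos |].
      replace (2 * S n)%nat with (2 * n + 2)%nat by lia.
      assert (Hr0 := cos_moment_rec (2 * n) 0).
      assert (Hp2 := cos_moment_pos (2 * n + 2)).
      assert (Hn := cos_moment_near (2 * n) z).
      assert (E1 : 1 <= INR (2 * n + 1)) by (change 1 with (INR 1); apply le_INR; lia).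
      assert (E2 : INR (2 * n + 2) = INR (2 * n + 1) + 1) by (rewrite -S_INR; f_equal; lia).
      assert (E3 : INR (S n) <= INR (2 * n + 1)) by (apply le_INR; lia).
      assert (E4 : 0 < INR (S n)) by (apply lt_0_INR; lia).
      rewrite E2 in Hr0.
      set (A := cos_moment (2 * n + 2) z) in *; set (A0 := cos_moment (2 * n + 2) 0) in *.
      set (B0 := cos_moment (2 * n) 0) in *; set (M := INR (2 * n + 1)) in *.
      assert (HB : B0 - A0 = A0 / M).
      { replace B0 with (((M + 1) ^ 2 - 4 * 0 ^ 2) * A0 / ((M + 1) * M)) by (rewrite Hr0; field; lra).
        field; lra. }
      rewrite HB in Hn.
      replace (1 - A / A0) with ((A0 - A) / A0) by (field; lra).
      unfold Rdiv; rewrite Rabs_mult (Rabs_pos_eq (/ A0)); [| apply Rlt_le, Rinv_0_lt_compat; lra].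
      apply Rle_trans with (2 * z ^ 2 * (A0 / M) * / A0).
      + apply Rmult_le_compat_r; auto; apply Rlt_le, Rinv_0_lt_compat; lra.
      + replace (2 * z ^ 2 * (A0 / M) * / A0) with (2 * z ^ 2 * / M) by (field; lra).
        apply Rmult_le_compat_l; [generalize (pow2_ge_0 z); lra |].
        apply Rinv_le_contravar; auto.
    - apply is_lim_seq_const.
    - replace (Finite 0) with (Finite (2 * z ^ 2 * 0)) by (f_equal; ring).
      apply (is_lim_seq_scal_l _ _ 0).
      apply (is_lim_seq_incr_1 (fun n => / INR n)).
      replace (Finite 0) with (Rbar_inv p_infty) by reflexivity.
      apply is_lim_seq_inv; [apply is_lim_seq_INR | discriminate]. }
  apply is_lim_seq_ext_loc with (u := fun n => (sin (PI * z) / (PI * z)) /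
     (cos_moment (2 * n) z / cos_moment (2 * n) 0)).
  - assert (H0 : eventually (fun n => cos_moment (2 * n) z / cos_moment (2 * n) 0 <> 0)).
    { apply is_lim_seq_spec in HR.
      destruct (HR (mkposreal _ Rlt_0_1)) as [N HN]; simpl in HN.
      exists N; intros n Hn E; specialize (HN n Hn).
      rewrite E in HN; apply Rabs_lt_between in HN; lra. }
    apply filter_imp with (2 := H0); intros n Hn.
    rewrite <- (sine_product_moment z n Hz).
    set (r := cos_moment (2 * n) z / cos_moment (2 * n) 0) in *; field; auto.
  - replace (Finite (sin (PI * z) / (PI * z))) with (Finite (sin (PI * z) / (PI * z) / 1))
      by (f_equal; field; split; [auto | generalize PI_RGT_0; lra]).
    apply is_lim_seq_div'; auto using is_lim_seq_const; lra.
Qed.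

(** * Gauss' limit for the reciprocal Gamma function, and its reflection formula *)

Definition gauss (z : R) (n : nat) : R :=
  rising z (S n) / (INR (Factorial.fact n) * exp (z * ln (INR n))).

(** [real (Lim_seq _)] returns some value even without a finite limit, so all that follows is proved
    as genuine convergence of [gauss] and transferred to [rgamma] only here. *)
Lemma rgamma_of_lim (z l : R) : is_lim_seq (gauss z) l -> rgamma z = l.
Proof.
  intros H; apply is_lim_seq_unique in H.
  unfold rgamma; change (real (Lim_seq (gauss z)) = l); now rewrite H.
Qed.

(** Convexity, [e^{a u} <= 1 - a + a e^u] at [u = s - h], obtained by averaging the tangent bounds
    at [(1 - a) u] and [- a u]. The point [h] is free: it is [ln n] for Gauss' limit and is tuned
    again for the domination along Hankel's contour. *)
Lemma exp_mul_le_tangent (a s h : R) : 0 <= a <= 1 ->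
  exp (a * s) <= exp (a * h) * (1 - a + a * exp (s - h)).
Proof.
  intros Ha.
  replace (a * s) with (a * h + a * (s - h)) by ring.
  rewrite exp_plus; apply Rmult_le_compat_l; [apply Rlt_le, exp_pos |].
  set (u := s - h).
  assert (H1 := exp_ge_tangent (u - a * u)); assert (H2 := exp_ge_tangent (- (a * u))).
  assert (Hm := exp_pos (a * u)).
  replace (exp u) with (exp (a * u) * exp (u - a * u)) by (rewrite -exp_plus; f_equal; ring).
  assert (H3 : 1 = exp (a * u) * exp (- (a * u))).
  { rewrite -exp_plus Rplus_opp_r exp_0; auto. }
  replace (1 - a) with ((1 - a) * (exp (a * u) * exp (- (a * u)))) by (rewrite -H3; ring).
  replace (_ + _) with (exp (a * u) * ((1 - a) * exp (- (a * u)) + a * exp (u - a * u))) by ring.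
  rewrite -{1}(Rmult_1_r (exp (a * u))).
  apply Rmult_le_compat_l; nra.
Qed.

(* Log-convexity of [gam], in the tangent form that Gauss' formula needs. *)
Lemma gam_interpolate (a b n : R) : 0 <= a <= 1 -> 0 < b -> 0 < n ->
  gam (b + a) <= exp (a * ln n) * ((1 - a) * gam b + a / n * gam (b + 1)).
Proof.
  intros Ha Hb Hn.
  apply (lim_int_le (fun s => exp ((b + a) * s - exp s))
    (fun s => exp (a * ln n) * ((1 - a) * exp (b * s - exp s)
                                + a / n * exp ((b + 1) * s - exp s)))).
  - smooth.
  - smooth.
  - intros s.
    replace ((b + a) * s - exp s) with ((b * s - exp s) + a * s) by ring.
    replace ((b + 1) * s - exp s) with ((b * s - exp s) + s) by ring.
    rewrite !(exp_plus (b * s - exp s)).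
    assert (H := exp_mul_le_tangent a s (ln n) Ha).
    assert (E : exp (s - ln n) = exp s / n).
    { unfold Rminus; rewrite exp_plus exp_Ropp exp_ln; auto. }
    rewrite E in H.
    apply Rle_trans with (exp (b * s - exp s) * (exp (a * ln n) * (1 - a + a * (exp s / n)))).
    + apply Rmult_le_compat_l; auto; apply Rlt_le, exp_pos.
    + right; field; lra.
  - apply lim_int_gam; lra.
  - apply lim_int_scal; [smooth |].
    apply lim_int_plus; try smooth; apply lim_int_scal; try smooth; apply lim_int_gam; lra.
Qed.

Lemma is_lim_seq_inv_INR : is_lim_seq (fun n => / INR n) 0.
Proof.
  replace (Finite 0) with (Rbar_inv p_infty) by reflexivity.
  apply is_lim_seq_inv; [apply is_lim_seq_INR | discriminate].
Qed.

Lemma gauss_lim_gam (a : R) : 0 < a < 1 -> is_lim_seq (gauss a) (/ gam a).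
Proof.
  intros Ha.
  assert (Hg := gam_pos a ltac:(lra)).
  apply (is_lim_seq_le_le_loc (fun _ => / gam a) _ (fun n => (1 + a * / INR n) * / gam a)).
  - exists 1%nat; intros n Hn.
    assert (Hn' : 0 < INR n) by (apply lt_0_INR; lia).
    assert (Hf : 0 < INR (Factorial.fact n)) by apply INR_fact_lt_0.
    assert (E : gauss a n = gam (INR n + 1 + a) / (INR (Factorial.fact n) * exp (a * ln (INR n))) * / gam a).
    { unfold gauss.
      replace (INR n + 1 + a) with (a + INR (S n)) by (rewrite S_INR; ring).
      rewrite gam_rising; [| lra]; field; split; [| split]; try lra.
      generalize (exp_pos (a * ln (INR n))); lra. }
    (* [U] gives [gam (n + 1 + a) <= n! n^a (1 + a / n)]. For the lower bound, [L] reaches [n + 2]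
       from [n + 1 + a] by a step [1 - a]; it becomes [(n + 1) n! n^a <= gam (n + 1 + a) (n + 1 -
       a^2)], and dropping [a^2] leaves no error term. *)
    assert (U := gam_interpolate a (INR n + 1) (INR n) ltac:(lra) ltac:(lra) Hn').
    assert (L := gam_interpolate (1 - a) (INR n + 1 + a) (INR n) ltac:(lra) ltac:(lra) Hn').
    replace (INR n + 1 + a + (1 - a)) with (INR n + 1 + 1) in L by ring.
    rewrite (gam_succ (INR n + 1 + a)) in L; [| lra].
    rewrite (gam_succ (INR n + 1)) in U; [| lra].
    rewrite (gam_succ (INR n + 1)) in L; [| lra].
    rewrite gam_fact in L, U.
    assert (X : exp ((1 - a) * ln (INR n)) = INR n / exp (a * ln (INR n))).
    { replace ((1 - a) * ln (INR n)) with (ln (INR n) + - (a * ln (INR n))) by ring.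
      rewrite exp_plus exp_Ropp exp_ln; auto. }
    rewrite X in L.
    assert (Hx := exp_pos (a * ln (INR n))).
    rewrite E.
    set (e := exp (a * ln (INR n))) in *; set (f := INR (Factorial.fact n)) in *.
    set (g := gam (INR n + 1 + a)) in *; set (m := INR n) in *.
    assert (Hfe : 0 < f * e) by now apply Rmult_lt_0_compat.
    split.
    + rewrite -{1}(Rmult_1_l (/ gam a)); apply Rmult_le_compat_r; [apply Rlt_le, Rinv_0_lt_compat; auto |].
      apply Rmult_le_reg_r with (f * e); auto.
      replace (g / (f * e) * (f * e)) with g by (field; split; lra).
      rewrite Rmult_1_l.
      apply Rmult_le_reg_r with (m + 1); [lra |].
      apply Rle_trans with (g * (m + 1 - a ^ 2)).
      * replace (g * (m + 1 - a ^ 2)) with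
          (e * (m / e * ((1 - (1 - a)) * g + (1 - a) / m * ((m + 1 + a) * g)))) by (field; lra).
        replace (f * e * (m + 1)) with (e * ((m + 1) * f)) by ring.
        apply Rmult_le_compat_l; lra.
      * apply Rmult_le_compat_l; [apply Rlt_le, gam_pos; lra | nra].
    + apply Rmult_le_compat_r; [apply Rlt_le, Rinv_0_lt_compat; auto |].
      apply Rmult_le_reg_r with (f * e); auto.
      replace (g / (f * e) * (f * e)) with g by (field; split; lra).
      eapply Rle_trans; [apply U | right; field; lra].
  - apply is_lim_seq_const.
  - replace (Finite (/ gam a)) with (Finite ((1 + a * 0) * / gam a)) by (f_equal; ring).
    apply (is_lim_seq_scal_r _ (/ gam a) (1 + a * 0)).
    apply is_lim_seq_plus'; [apply is_lim_seq_const |].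
    apply (is_lim_seq_scal_l _ a 0), is_lim_seq_inv_INR.
Qed.

(** The factor [a + k] of the first product meets [k - a] of the second for [k = 1, ..., n]; the
    unpaired factors are [a] and [n + 1 - a]. *)
Lemma rising_mul_reflect (a : R) (n : nat) :
  rising a (S n) * rising (1 - a) (S n)
    = a * (INR n + 1 - a) * INR (Factorial.fact n) ^ 2 * sine_product a n.
Proof.
  induction n as [|n IH].
  - simpl; ring.
  - change (rising a (S (S n))) with (rising a (S n) * (a + INR (S n))).
    change (rising (1 - a) (S (S n))) with (rising (1 - a) (S n) * (1 - a + INR (S n))).
    change (sine_product a (S n)) with (sine_product a n * (1 - a ^ 2 / INR (S n) ^ 2)).
    replace (Factorial.fact (S n)) with (S n * Factorial.fact n)%nat by reflexivity.
    rewrite mult_INR.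
    transitivity ((rising a (S n) * rising (1 - a) (S n)) * ((a + INR (S n)) * (1 - a + INR (S n))));
      [ring |].
    rewrite IH !S_INR; field.
    generalize (pos_INR n); lra.
Qed.

(** [gauss a n] times [gauss (1 - a) n] equals [a * sine_product a n] up to a factor
    [1 + (1 - a) / n], and the limit of [gauss a] is known and nonzero. *)
Lemma gauss_lim_reflect (a : R) : 0 < a < 1 ->
  is_lim_seq (gauss (1 - a)) (gam a * sin (PI * a) / PI).
Proof.
  intros Ha; generalize PI_RGT_0; intros HP.
  assert (Hg := gam_pos a ltac:(lra)).
  assert (H1 := gauss_lim_gam a Ha).
  assert (Hpos : forall z n, 0 < z -> 0 < rising z n).
  { intros z n Hz; induction n as [|n IH]; simpl; [lra |].
    apply Rmult_lt_0_compat; auto; generalize (pos_INR n); lra. }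
  apply is_lim_seq_ext_loc with
    (u := fun n => (a * sine_product a n * (1 + (1 - a) * / INR n)) / gauss a n).
  - exists 1%nat; intros n Hn.
    assert (Hn' : 0 < INR n) by (apply lt_0_INR; lia).
    assert (Hf : 0 < INR (Factorial.fact n)) by apply INR_fact_lt_0.
    assert (R1 := rising_mul_reflect a n).
    assert (R2 := Hpos a (S n) ltac:(lra)).
    assert (Hx := exp_pos (a * ln (INR n))).
    assert (X : exp ((1 - a) * ln (INR n)) = INR n / exp (a * ln (INR n))).
    { replace ((1 - a) * ln (INR n)) with (ln (INR n) + - (a * ln (INR n))) by ring.
      rewrite exp_plus exp_Ropp exp_ln; auto. }
    unfold gauss; rewrite X.
    replace (rising (1 - a) (S n)) with
      (a * (INR n + 1 - a) * INR (Factorial.fact n) ^ 2 * sine_product a n / rising a (S n))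
      by (rewrite -R1; field; lra).
    field; repeat split; lra.
  - replace (Finite (gam a * sin (PI * a) / PI)) with
      (Finite ((a * (sin (PI * a) / (PI * a)) * (1 + (1 - a) * 0)) / / gam a))
      by (f_equal; field; lra).
    apply is_lim_seq_div'; auto.
    + apply is_lim_seq_mult'.
      * apply (is_lim_seq_scal_l _ a (sin (PI * a) / (PI * a))), sine_product_lim; lra.
      * apply is_lim_seq_plus'; [apply is_lim_seq_const |].
        apply (is_lim_seq_scal_l _ (1 - a) 0), is_lim_seq_inv_INR.
    + apply Rgt_not_eq, Rinv_0_lt_compat, Hg.
Qed.

Lemma rising_shift (z : R) (n : nat) : rising z (S n) = z * rising (z + 1) n.
Proof.
  induction n as [|n IH].
  - simpl; ring.
  - change (rising z (S (S n))) with (rising z (S n) * (z + INR (S n))).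
    rewrite IH S_INR; simpl; ring.
Qed.

(** The functional equation [1 / Gamma (z) = z / Gamma (z + 1)], convergence included, which carries
    limits leftwards past the poles of [Gamma]. *)
Lemma gauss_lim_pred (z l : R) : is_lim_seq (gauss (z + 1)) l -> is_lim_seq (gauss z) (z * l).
Proof.
  intros H.
  apply is_lim_seq_ext_loc with
    (u := fun n => (z * gauss (z + 1) n) / (1 + (z + 1) * / INR n)).
  - destruct (nfloor_ex (Rabs (z + 1)) (Rabs_pos _)) as [N HN].
    exists (S N); intros n Hn.
    assert (Hn' : 0 < INR n) by (apply lt_0_INR; lia).
    assert (Hf : 0 < INR (Factorial.fact n)) by apply INR_fact_lt_0.
    apply le_INR in Hn; rewrite S_INR in Hn.
    assert (Hz : INR n + (z + 1) <> 0).
    { generalize (Rle_abs (- (z + 1))); rewrite Rabs_Ropp; lra. }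
    unfold gauss; rewrite (rising_shift z).
    change (rising (z + 1) (S n)) with (rising (z + 1) n * (z + 1 + INR n)).
    replace ((z + 1) * ln (INR n)) with (z * ln (INR n) + ln (INR n)) by ring.
    rewrite exp_plus exp_ln; auto.
    field; repeat split; try lra.
    generalize (exp_pos (z * ln (INR n))); lra.
  - replace (Finite (z * l)) with (Finite (z * l / (1 + (z + 1) * 0))) by (f_equal; field; lra).
    apply is_lim_seq_div'; [| | lra].
    + now apply (is_lim_seq_scal_l _ z l).
    + apply is_lim_seq_plus'; [apply is_lim_seq_const |].
      apply (is_lim_seq_scal_l _ (z + 1) 0), is_lim_seq_inv_INR.
Qed.

(** Induction on an integer bound for [a], one functional equation per step: replacing [a - 1] by
    [a] multiplies [gam] by [a - 1] and changes the sign of the sine. Written with [gam a] and the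
    sine as factors, the formula also covers integer [a], where it gives [0]. *)
Lemma gauss_lim_one_sub (a : R) : 0 < a -> is_lim_seq (gauss (1 - a)) (gam a * sin (PI * a) / PI).
Proof.
  generalize PI_RGT_0; intros HP.
  assert (H : forall m a, 0 < a <= INR m + 1 ->
     is_lim_seq (gauss (1 - a)) (gam a * sin (PI * a) / PI)).
  { clear a; induction m as [|m IH]; intros a Ha.
    - simpl in Ha; destruct (Req_dec a 1) as [->|H1]; [| apply gauss_lim_reflect; lra].
      rewrite Rmult_1_r sin_PI.
      apply is_lim_seq_ext with (u := fun _ => gam 1 * 0 / PI); [| apply is_lim_seq_const].
      intros n; unfold gauss; rewrite rising_shift; unfold Rdiv; ring.
    - rewrite S_INR in Ha.
      destruct (Rle_dec a (INR m + 1)) as [H1|H1]; [apply IH; lra |].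
      assert (Hm := pos_INR m).
      replace (gam a * sin (PI * a) / PI) with ((1 - a) * (gam (a - 1) * sin (PI * (a - 1)) / PI)).
      + apply gauss_lim_pred.
        replace (1 - a + 1) with (1 - (a - 1)) by ring.
        apply IH; lra.
      + replace a with (a - 1 + 1) at 4 by ring.
        rewrite gam_succ; [| lra].
        replace (PI * a) with (PI * (a - 1) + PI) by ring.
        rewrite neg_sin; field; lra. }
  intros Ha; destruct (nfloor_ex a) as [m Hm]; [lra |].
  apply (H m); lra.
Qed.

Lemma rgamma_one_sub (a : R) : 0 < a -> rgamma (1 - a) = gam a * sin (PI * a) / PI.
Proof. intros Ha; now apply rgamma_of_lim, gauss_lim_one_sub. Qed.

(** The point [1 / 2] is fixed by reflection, so Gauss' limit there equals both [/ gam (/ 2)] and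
    [gam (/ 2) / PI]. *)
Lemma gam_half : gam (/ 2) = sqrt PI.
Proof.
  generalize PI_RGT_0; intros HP.
  assert (Hg := gam_pos (/ 2) ltac:(lra)).
  assert (H1 := gauss_lim_gam (/ 2) ltac:(lra)).
  assert (H2 := gauss_lim_one_sub (/ 2) ltac:(lra)).
  replace (1 - / 2) with (/ 2) in H2 by field.
  apply rgamma_of_lim in H1; apply rgamma_of_lim in H2.
  rewrite H1 in H2.
  replace (PI * / 2) with (PI / 2) in H2 by reflexivity.
  rewrite sin_PI2 in H2.
  symmetry; apply sqrt_lem_1; try lra.
  apply Rmult_eq_reg_l with (/ gam (/ 2) * / PI).
  - transitivity (gam (/ 2) * 1 / PI); [field; lra | rewrite -H2; field; lra].
  - apply Rgt_not_eq, Rmult_lt_0_compat; apply Rinv_0_lt_compat; auto.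
Qed.

(** * Hankel's representation of the Wright function *)

Lemma le_of_derive_le (F G f g : R -> R) (z : R) : 0 <= z ->
  (forall c, is_derive F c (f c)) -> (forall c, is_derive G c (g c)) ->
  F 0 <= G 0 -> (forall c, 0 <= c -> f c <= g c) -> F z <= G z.
Proof.
  intros Hz HF HG H0 Hfg.
  destruct (MVT_gen (fun s => G s - F s) 0 z (fun s => g s - f s)) as [c [Hc E]].
  - intros x _; apply: is_derive_minus; auto.
  - intros x _; apply continuity_pt_filterlim.
    apply (ex_derive_continuous (fun s => G s - F s)); apply: ex_derive_minus; eexists; eauto.
  - rewrite Rmin_left in Hc; auto.
    generalize (Hfg c ltac:(lra)); intros H.
    assert (0 <= (g c - f c) * (z - 0)) by (apply Rmult_le_pos; lra).
    lra.
Qed.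

Lemma is_derive_pow_fact (n : nat) (z : R) :
  is_derive (fun z => z ^ S n / INR (Factorial.fact (S n))) z (z ^ n / INR (Factorial.fact n)).
Proof.
  auto_derive; auto.
  change (Nat.pred (S n)) with n.
  replace (Factorial.fact n + n * Factorial.fact n)%nat with (S n * Factorial.fact n)%nat by reflexivity.
  change (match n with 0%nat => 1 | S _ => INR n + 1 end) with (INR (S n)).
  rewrite mult_INR; field.
  split; [apply INR_fact_neq_0 | apply not_0_INR; lia].
Qed.

Lemma pow_fact_le_exp (n : nat) (z : R) : 0 <= z -> z ^ n / INR (Factorial.fact n) <= exp z.
Proof.
  revert z; induction n as [|n IH]; intros z Hz.
  - simpl; generalize (exp_ge_tangent z); lra.
  - apply (le_of_derive_le (fun z => z ^ S n / INR (Factorial.fact (S n))) exp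
             (fun z => z ^ n / INR (Factorial.fact n)) exp); auto.
    + intros c; apply is_derive_pow_fact.
    + intros c; apply is_derive_Reals, derivable_pt_lim_exp.
    + rewrite exp_0 pow_i; [| lia]; unfold Rdiv; lra.
Qed.

(* Taylor polynomials at [z = 0] of [z |-> Im (e^{i b} exp (- z e^{i g}))]. *)
Fixpoint osc_taylor (g b z : R) (n : nat) : R :=
  match n with
  | O => 0
  | S m => osc_taylor g b z m + (- z) ^ m / INR (Factorial.fact m) * sin (b + INR m * g)
  end.

Lemma is_derive_osc_taylor (g b z : R) (n : nat) :
  is_derive (fun z => osc_taylor g b z (S n)) z (- osc_taylor g (b + g) z n).
Proof.
  induction n as [|n IH].
  - simpl; auto_derive; auto; field.
  - apply (is_derive_ext (fun z => plus (osc_taylor g b z (S n))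
      ((- z) ^ S n / INR (Factorial.fact (S n)) * sin (b + INR (S n) * g)))).
    + reflexivity.
    + replace (- osc_taylor g (b + g) z (S n)) with
        (plus (- osc_taylor g (b + g) z n)
           (- ((- z) ^ n / INR (Factorial.fact n)) * sin (b + INR (S n) * g))).
      * apply: is_derive_plus; auto.
        apply (is_derive_ext (fun z => scal (sin (b + INR (S n) * g))
            ((- z) ^ S n / INR (Factorial.fact (S n))))).
        { intros t; unfold scal; simpl; unfold mult; simpl; ring. }
        replace (- ((- z) ^ n / INR (Factorial.fact n)) * sin (b + INR (S n) * g)) with
          (scal (sin (b + INR (S n) * g)) (scal (-1) ((- z) ^ n / INR (Factorial.fact n))))
          by (unfold scal; simpl; unfold mult; simpl; ring).
        apply: is_derive_scal.
        apply (is_derive_comp (fun z => z ^ S n / INR (Factorial.fact (S n))) (fun z => - z)).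
        -- apply is_derive_pow_fact.
        -- auto_derive; auto; ring.
      * unfold plus; simpl osc_taylor; rewrite S_INR; simpl.
        replace (b + g + INR n * g) with (b + (INR n + 1) * g) by ring; ring.
Qed.

Lemma osc_taylor_0 (g b : R) (n : nat) : osc_taylor g b 0 (S n) = sin b.
Proof.
  induction n as [|n IH].
  - simpl; rewrite Rmult_0_l Rplus_0_r; field.
  - change (osc_taylor g b 0 (S (S n))) with (osc_taylor g b 0 (S n)
      + (- 0) ^ S n / INR (Factorial.fact (S n)) * sin (b + INR (S n) * g)).
    rewrite IH Ropp_0 pow_i; [| lia]; unfold Rdiv; ring.
Qed.

(** Differentiating [e^{i b} exp (- z e^{i g})] multiplies it by [- e^{i g}]: the derivative of a
    remainder is minus the remainder of the previous order at phase [b + g]. The induction therefore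
    quantifies over [b]; it starts from modulus at most [1], thanks to [cos g >= 0]. *)
Lemma osc_taylor_remainder (g b z : R) (n : nat) : 0 <= cos g -> 0 <= z ->
  Rabs (exp (- z * cos g) * sin (b - z * sin g) - osc_taylor g b z n)
    <= z ^ n / INR (Factorial.fact n).
Proof.
  intros Hg; revert b z; induction n as [|n IH]; intros b z Hz.
  - simpl osc_taylor; rewrite Rminus_0_r; simpl.
    replace (1 / 1) with (exp 0) by (rewrite exp_0; field).
    apply abs_exp_mul_le; [apply abs_sin_le_1 |].
    generalize (Rmult_le_pos z (cos g)); lra.
  - set (f := fun b z => exp (- z * cos g) * sin (b - z * sin g)) in *.
    assert (Hf : forall c, is_derive (fun z => f b z - osc_taylor g b z (S n)) c
               (- (f (b + g) c - osc_taylor g (b + g) c n))).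
    { intros c.
      replace (- (f (b + g) c - osc_taylor g (b + g) c n))
        with (minus (- f (b + g) c) (- osc_taylor g (b + g) c n))
        by (unfold minus, plus, opp; simpl; ring).
      apply: is_derive_minus; [| apply is_derive_osc_taylor].
      unfold f; auto_derive; auto.
      replace (b + g - c * sin g) with ((b - c * sin g) + g) by ring.
      rewrite (sin_plus (b - c * sin g) g); unfold Rminus; ring. }
    assert (H0 : f b 0 - osc_taylor g b 0 (S n) = 0).
    { rewrite osc_taylor_0; unfold f.
      rewrite Ropp_0 !Rmult_0_l exp_0 Rminus_0_r; ring. }
    assert (H1 : 0 ^ S n / INR (Factorial.fact (S n)) = 0).
    { rewrite pow_i; [| lia]; unfold Rdiv; ring. }
    apply Rabs_le; split.
    + apply Ropp_le_cancel; rewrite Ropp_involutive.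
      apply (le_of_derive_le (fun z => - (f b z - osc_taylor g b z (S n)))
               (fun z => z ^ S n / INR (Factorial.fact (S n)))
               (fun c => - - (f (b + g) c - osc_taylor g (b + g) c n))
               (fun z => z ^ n / INR (Factorial.fact n))); auto.
      * intros c; apply: is_derive_opp; apply Hf.
      * intros c; apply is_derive_pow_fact.
      * rewrite H0 H1; lra.
      * intros c Hc; destruct (proj1 (Rabs_le_between _ _) (IH (b + g) c Hc)) as [H2 H3]; unfold f; lra.
    + apply (le_of_derive_le (fun z => f b z - osc_taylor g b z (S n))
               (fun z => z ^ S n / INR (Factorial.fact (S n)))
               (fun c => - (f (b + g) c - osc_taylor g (b + g) c n))
               (fun z => z ^ n / INR (Factorial.fact n))); auto.
      * intros c; apply is_derive_pow_fact.
      * rewrite H0 H1; lra.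
      * intros c Hc; destruct (proj1 (Rabs_le_between _ _) (IH (b + g) c Hc)) as [H2 H3]; unfold f; lra.
Qed.

Lemma exp_mul_dominated (mu y e : R) : 0 < mu < 1 -> 0 <= y -> 0 < e ->
  exists C, forall s, y * exp (mu * s) <= C + e * exp s.
Proof.
  intros Hmu Hy He.
  assert (Hq : 0 < y / e + 1) by (assert (0 <= y / e) by (apply Rdiv_le_0_compat; lra); lra).
  (* This [h] satisfies [exp ((1 - mu) h) = y / e + 1], which brings the coefficient of [exp s] down
     to [mu y e / (y + e)], below [e]; the [+ 1] keeps the logarithm meaningful at [y = 0]. *)
  set (h := ln (y / e + 1) / (1 - mu)).
  exists (y * (exp (mu * h) * (1 - mu))); intros s.
  apply Rle_trans with (y * (exp (mu * h) * (1 - mu + mu * exp (s - h)))).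
  { apply Rmult_le_compat_l; auto; apply exp_mul_le_tangent; lra. }
  assert (E : exp (mu * h) * exp (s - h) = exp s / (y / e + 1)).
  { rewrite -exp_plus; replace (mu * h + (s - h)) with (s + - ((1 - mu) * h)) by ring.
    replace ((1 - mu) * h) with (ln (y / e + 1)) by (unfold h; field; lra).
    rewrite exp_plus exp_Ropp exp_ln; auto. }
  replace (y * (exp (mu * h) * (1 - mu + mu * exp (s - h))))
    with (y * (exp (mu * h) * (1 - mu)) + mu * y * (exp (mu * h) * exp (s - h))) by ring.
  rewrite E; apply Rplus_le_compat_l.
  replace (mu * y * (exp s / (y / e + 1))) with (mu * y * e / (y + e) * exp s) by (field; lra).
  apply Rmult_le_compat_r; [apply Rlt_le, exp_pos |].
  apply Rmult_le_reg_r with (y + e); [lra |].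
  replace (mu * y * e / (y + e) * (y + e)) with (mu * y * e) by (field; lra).
  assert (0 <= (1 - mu) * (y * e)); [| nra].
  apply Rmult_le_pos; [lra | apply Rmult_le_pos; lra].
Qed.

(* Terms of the Wright function [M_mu (y) = sum_k (- y)^k / (k! Gamma (1 - mu - mu k))]. *)
Definition wright_term (mu y : R) (k : nat) : R :=
  (- y) ^ k / INR (Factorial.fact k) * rgamma (1 - mu * INR (S k)).

(* The imaginary part of [exp (z - y z^mu) z^mu] at [z = e^{s + i phi}]: Hankel's contour,
   made of the two rays of argument [phi] and [- phi]. *)
Definition hankel (mu phi y s : R) : R :=
  exp (mu * s + cos phi * exp s - y * cos (mu * phi) * exp (mu * s))
  * sin (mu * phi + sin phi * exp s - y * sin (mu * phi) * exp (mu * s)).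

Lemma continuous_hankel (mu phi y s : R) : continuous (hankel mu phi y) s.
Proof. revert s; unfold hankel; smooth. Qed.

Lemma hankel_le_left (mu phi y s : R) : 0 <= y -> cos phi <= 0 -> 0 <= cos (mu * phi) ->
  Rabs (hankel mu phi y s) <= 1 * exp (mu * s).
Proof.
  intros Hy Hp Hm.
  rewrite Rmult_1_l; apply abs_exp_mul_le; [apply abs_sin_le_1 |].
  generalize (exp_pos s) (exp_pos (mu * s)); intros.
  assert (0 <= - cos phi * exp s) by (apply Rmult_le_pos; lra).
  assert (0 <= y * cos (mu * phi) * exp (mu * s)) by (repeat apply Rmult_le_pos; lra).
  lra.
Qed.

Lemma hankel_le_damped (mu phi y s : R) : 0 <= y -> 0 <= cos (mu * phi) ->
  Rabs (hankel mu phi y s) <= exp (mu * s - - cos phi * exp s).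
Proof.
  intros Hy Hm.
  apply abs_exp_mul_le; [apply abs_sin_le_1 |].
  generalize (exp_pos (mu * s)); intros.
  assert (0 <= y * cos (mu * phi) * exp (mu * s)) by (repeat apply Rmult_le_pos; lra).
  lra.
Qed.

Definition damping (a c : R) : R := exp ((a + 1) * ln ((a + 1) / c) - (a + 1)).

Lemma exp_damped_le (a c s : R) : 0 < a -> 0 < c ->
  exp (a * s - c * exp s) <= damping a c * exp (- 1 * s).
Proof.
  intros Ha Hc.
  generalize (damped_le_right a c c s 1); rewrite Rabs_R1 Rmult_1_r.
  intros H; apply Rle_trans with (2 := H Ha ltac:(lra) Hc ltac:(lra)), Rle_abs.
Qed.

Lemma hankel_le_right (mu phi y s : R) : 0 < mu -> 0 <= y -> cos phi < 0 -> 0 <= cos (mu * phi) ->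
  Rabs (hankel mu phi y s) <= damping mu (- cos phi) * exp (- 1 * s).
Proof.
  intros Hmu Hy Hp Hm.
  apply Rle_trans with (1 := hankel_le_damped mu phi y s Hy Hm).
  apply exp_damped_le; lra.
Qed.

(** Replacing [z] by [- z] turns the ray of argument [phi] into that of argument [phi - pi], within
    the range of Euler's integral; the phase [a pi] so created gives [sin (a pi) gam a], which
    reflection reads as [pi / Gamma (1 - a)]. *)
Lemma lim_int_hankel_term (a phi : R) : 0 < a -> PI / 2 < phi < PI ->
  lim_int (fun s => exp (a * s + cos phi * exp s) * sin (a * phi + sin phi * exp s))
    (PI * rgamma (1 - a)).
Proof.
  intros Ha Hp; generalize PI_RGT_0; intros HP.
  rewrite rgamma_one_sub; auto.
  replace (PI * (gam a * sin (PI * a) / PI)) with (sin (a * PI) * gam a)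
    by (rewrite (Rmult_comm a PI); field; lra).
  apply lim_int_ext with (2 := lim_int_gam_ray a (phi - PI) (a * PI) Ha ltac:(lra)).
  intros s.
  assert (Ec : cos (phi - PI) = - cos phi) by (rewrite cos_minus cos_PI sin_PI; ring).
  assert (Es : sin (phi - PI) = - sin phi) by (rewrite sin_minus cos_PI sin_PI; ring).
  rewrite Ec Es; f_equal; f_equal; ring.
Qed.


Lemma exp_pow (x : R) (n : nat) : exp x ^ n = exp (INR n * x).
Proof.
  induction n as [|n IH].
  - simpl; now rewrite Rmult_0_l exp_0.
  - rewrite S_INR Rmult_plus_distr_r Rmult_1_l Rplus_comm exp_plus -IH; reflexivity.
Qed.

(** Only the factor [exp (- y z^mu)] is expanded; [exp z] stays intact, so that each term is
    integrable along the contour and gives one reciprocal Gamma value. *)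
Definition hankel_partial (mu phi y : R) (n : nat) (s : R) : R :=
  exp (mu * s + cos phi * exp s)
  * osc_taylor (mu * phi) (mu * phi + sin phi * exp s) (y * exp (mu * s)) n.

Lemma hankel_partial_S (mu phi y : R) (n : nat) (s : R) :
  hankel_partial mu phi y (S n) s = hankel_partial mu phi y n s +
  (- y) ^ n / INR (Factorial.fact n)
  * (exp (mu * INR (S n) * s + cos phi * exp s) * sin (mu * INR (S n) * phi + sin phi * exp s)).
Proof.
  unfold hankel_partial; simpl osc_taylor.
  replace (mu * INR (S n) * s + cos phi * exp s) with
    ((mu * s + cos phi * exp s) + INR n * (mu * s)) by (rewrite S_INR; ring).
  rewrite (exp_plus (mu * s + cos phi * exp s)).
  replace (- (y * exp (mu * s))) with (- y * exp (mu * s)) by ring.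
  rewrite Rpow_mult_distr exp_pow.
  replace (mu * INR (S n) * phi + sin phi * exp s)
    with (mu * phi + sin phi * exp s + INR n * (mu * phi)) by (rewrite S_INR; ring).
  field; apply INR_fact_neq_0.
Qed.

Lemma hankel_partial_lim (mu phi y : R) (n : nat) : 0 < mu -> PI / 2 < phi < PI ->
  (forall s, continuous (hankel_partial mu phi y (S n)) s) /\
  lim_int (hankel_partial mu phi y (S n)) (PI * sum_n (wright_term mu y) n).
Proof.
  intros Hmu Hphi.
  assert (Ht : forall n, lim_int (fun s => (- y) ^ n / INR (Factorial.fact n)
      * (exp (mu * INR (S n) * s + cos phi * exp s) * sin (mu * INR (S n) * phi + sin phi * exp s)))
      (PI * wright_term mu y n)).
  { intros m; unfold wright_term.
    replace (PI * _) with ((- y) ^ m / INR (Factorial.fact m) * (PI * rgamma (1 - mu * INR (S m))))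
      by ring.
    apply lim_int_scal; [smooth |].
    apply lim_int_hankel_term; auto.
    apply Rmult_lt_0_compat; auto; apply lt_0_INR; lia. }
  assert (Hc : forall m s, continuous (fun s => (- y) ^ m / INR (Factorial.fact m)
      * (exp (mu * INR (S m) * s + cos phi * exp s) * sin (mu * INR (S m) * phi + sin phi * exp s))) s).
  { intros m; smooth. }
  induction n as [|n [IHc IHl]].
  - assert (E : forall s, (- y) ^ 0 / INR (Factorial.fact 0)
      * (exp (mu * INR 1 * s + cos phi * exp s) * sin (mu * INR 1 * phi + sin phi * exp s))
      = hankel_partial mu phi y 1 s).
    { intros s; rewrite hankel_partial_S; unfold hankel_partial; simpl osc_taylor.
      rewrite Rmult_0_r; ring. }
    split.
    + intros s; apply continuous_ext with (1 := E), Hc.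
    + rewrite sum_O; apply lim_int_ext with (1 := E), Ht.
  - split.
    + intros s; apply continuous_ext with (1 := fun s => eq_sym (hankel_partial_S mu phi y (S n) s)).
      apply: continuous_plus; auto.
    + rewrite sum_Sn; unfold plus; simpl AbelianMonoid.plus; rewrite Rmult_plus_distr_l.
      apply lim_int_ext with (1 := fun s => eq_sym (hankel_partial_S mu phi y (S n) s)).
      apply lim_int_plus; auto.
Qed.

(** With [E = e^{mu s}], the Taylor remainder [(y E)^n / n!] is [2^{-n} (2 y E)^n / n! <= 2^{-n}
    e^{2 y E}]. Since [mu < 1], half of the damping [cos phi e^s] absorbs [2 y E], and the other
    half keeps the bound integrable. *)
Lemma hankel_sub_partial (mu phi y : R) : 0 < mu < 1 -> PI / 2 < phi < PI -> 0 <= y ->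
  0 <= cos (mu * phi) -> exists K, forall n s,
  Rabs (hankel mu phi y s - hankel_partial mu phi y n s)
    <= (/ 2) ^ n * K * exp (mu * s - - cos phi / 2 * exp s).
Proof.
  intros Hmu Hphi Hy Hc.
  assert (Hp : cos phi < 0) by (apply cos_lt_0; lra).
  destruct (exp_mul_dominated mu (2 * y) (- cos phi / 2)) as [C HC]; try lra.
  exists (exp C); intros n s.
  set (E := exp (mu * s)).
  assert (HE : 0 < E) by apply exp_pos.
  assert (Hz : 0 <= y * E) by (apply Rmult_le_pos; lra).
  assert (Ef : hankel mu phi y s - hankel_partial mu phi y n s =
     exp (mu * s + cos phi * exp s) *
     (exp (- (y * E) * cos (mu * phi))
       * sin (mu * phi + sin phi * exp s - y * E * sin (mu * phi))
       - osc_taylor (mu * phi) (mu * phi + sin phi * exp s) (y * E) n)).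
  { unfold hankel, hankel_partial; fold E.
    rewrite Rmult_minus_distr_l -Rmult_assoc -exp_plus; f_equal; f_equal; f_equal; ring. }
  rewrite Ef Rabs_mult (Rabs_pos_eq (exp _)); [| apply Rlt_le, exp_pos].
  apply Rle_trans with (exp (mu * s + cos phi * exp s) * ((/ 2) ^ n * exp (2 * (y * E)))).
  - apply Rmult_le_compat_l; [apply Rlt_le, exp_pos |].
    eapply Rle_trans; [apply osc_taylor_remainder; auto |].
    replace ((y * E) ^ n / INR (Factorial.fact n)) with
      ((/ 2) ^ n * ((2 * (y * E)) ^ n / INR (Factorial.fact n))).
    + apply Rmult_le_compat_l; [apply pow_le; lra |].
      apply pow_fact_le_exp; lra.
    + rewrite Rpow_mult_distr -Rmult_assoc /Rdiv -!Rmult_assoc -Rpow_mult_distr.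
      replace (/ 2 * 2) with 1 by field; rewrite pow1; ring.
  - rewrite !(Rmult_comm (exp (mu * s + _))) !Rmult_assoc.
    apply Rmult_le_compat_l; [apply pow_le; lra |].
    rewrite -!exp_plus; apply exp_le.
    specialize (HC s); fold E in HC; lra.
Qed.

(** The integral exists by damping, and the partial sums approach it at a geometric rate;
    convergence of the series is thus a conclusion. *)
Lemma hankel_series (mu phi y : R) : 0 < mu < 1 -> PI / 2 < phi < PI -> 0 <= y ->
  0 < cos (mu * phi) ->
  ex_series (wright_term mu y) /\ lim_int (hankel mu phi y) (PI * Series (wright_term mu y)).
Proof.
  intros Hmu Hphi Hy Hc; generalize PI_RGT_0; intros HP.
  assert (Hp : cos phi < 0) by (apply cos_lt_0; lra).
  destruct (lim_int_ex (hankel mu phi y) mu 1 1 (damping mu (- cos phi))) as [L HL]; try lra.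
  { apply continuous_hankel. }
  { intros s; apply hankel_le_left; lra. }
  { intros s; apply hankel_le_right; lra. }
  destruct (hankel_sub_partial mu phi y Hmu Hphi Hy ltac:(lra)) as [K HK].
  set (c := - cos phi / 2) in *.
  assert (Hs : is_lim_seq (fun n => PI * sum_n (wright_term mu y) n) L).
  { apply is_lim_seq_ext with (u := fun n => L - (L - PI * sum_n (wright_term mu y) n)).
    { intros; ring. }
    replace (Finite L) with (Finite (L - 0)) by (f_equal; ring).
    apply is_lim_seq_minus'; [apply is_lim_seq_const |].
    apply is_lim_seq_abs_0.
    apply is_lim_seq_le_le with (u := fun _ => 0)
      (w := fun n => (K / mu + K * damping mu c / 1) * (/ 2) ^ S n).
    - intros n; split; [apply Rabs_pos |].
      destruct (hankel_partial_lim mu phi y n ltac:(lra) Hphi) as [Pc Pl].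
      assert (Q : 0 <= (/ 2) ^ S n * K).
      { generalize (Rle_trans _ _ _ (Rabs_pos _) (HK (S n) 0)).
        generalize (exp_pos (mu * 0 - c * exp 0)); intros He H.
        apply Rmult_le_reg_r with (1 := He); lra. }
      assert (B := lim_int_abs_le (fun s => hankel mu phi y s - hankel_partial mu phi y (S n) s)
        mu ((/ 2) ^ S n * K) 1 ((/ 2) ^ S n * K * damping mu c)
        (L - PI * sum_n (wright_term mu y) n)).
      eapply Rle_trans; [apply B | right; field; lra]; clear B; try lra.
      + intros s; apply: continuous_minus; auto; apply continuous_hankel.
      + intros s; apply Rle_trans with (1 := HK (S n) s).
        apply Rmult_le_compat_l; auto; apply exp_le.
        assert (0 <= c * exp s) by (apply Rmult_le_pos; [unfold c; lra | apply Rlt_le, exp_pos]).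
        lra.
      + intros s; apply Rle_trans with (1 := HK (S n) s).
        rewrite (Rmult_assoc (_ * K)).
        apply Rmult_le_compat_l; auto; apply exp_damped_le; unfold c; lra.
      + apply lim_int_minus; auto; apply continuous_hankel.
    - apply is_lim_seq_const.
    - replace (Finite 0) with (Finite ((K / mu + K * damping mu c / 1) * 0)) by (f_equal; ring).
      apply (is_lim_seq_scal_l _ _ 0).
      apply (is_lim_seq_incr_1 (fun n => (/ 2) ^ n)).
      apply is_lim_seq_geom; rewrite Rabs_pos_eq; lra. }
  assert (Hser : is_series (wright_term mu y) (L / PI)).
  { apply (is_lim_seq_ext (fun n => / PI * (PI * sum_n (wright_term mu y) n)) _ (L / PI)).
    { intros n; change (/ PI * (PI * sum_n (wright_term mu y) n) = sum_n (wright_term mu y) n); field; lra. }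
    replace (L / PI) with (/ PI * L) by (unfold Rdiv; ring).
    now apply (is_lim_seq_scal_l _ _ L). }
  split.
  - eexists; apply Hser.
  - rewrite (is_series_unique _ _ Hser).
    replace (PI * (L / PI)) with L by (field; lra); auto.
Qed.

(** * The Gaussian kernel at a complex parameter *)

Lemma is_derive_RInt_cont (f : R -> R) (a s : R) :
  (forall s, continuous f s) -> is_derive (fun s => RInt f a s) s (f s).
Proof.
  intros Hf; apply (is_derive_RInt f _ a s); auto.
  apply filter_forall; intros; apply: RInt_correct; now apply ex_RInt_cont.
Qed.

Lemma lim_int_translate (f : R -> R) (a C d D L h : R) : 0 < a -> 0 < d ->
  (forall s, continuous f s) ->
  (forall s, Rabs (f s) <= C * exp (a * s)) -> (forall s, Rabs (f s) <= D * exp (- d * s)) ->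
  lim_int f L -> lim_int (fun s => f (s + h)) L.
Proof.
  intros Ha Hd Hf HC HD HL.
  apply is_lim_seq_ext with (u := fun n => L + (RInt f (- INR n + h) (INR n + h) - L)).
  { intros n; symmetry.
    transitivity (RInt f (1 * - INR n + h) (1 * INR n + h)).
    - rewrite <- (RInt_comp_lin f 1 h); [| now apply ex_RInt_cont].
      apply RInt_ext; intros s _.
      unfold scal; simpl; unfold mult; simpl; rewrite !Rmult_1_l; auto.
    - rewrite !Rmult_1_l; symmetry; apply Rplus_minus. }
  replace (Finite L) with (Finite (L + 0)) by (f_equal; ring).
  apply is_lim_seq_plus'; [apply is_lim_seq_const |].
  apply is_lim_seq_abs_0.
  apply is_lim_seq_le_le with (u := fun _ => 0)
    (w := fun n => (C / a * exp (a * h)) * exp (a * - INR n) + (D / d * exp (- d * h)) * exp (- d * INR n)).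
  - intros n; split; [apply Rabs_pos |].
    eapply Rle_trans; [apply (lim_int_tail f a C d D L) | right]; auto.
    rewrite !Rmult_plus_distr_l !exp_plus; ring.
  - apply is_lim_seq_const.
  - now apply is_lim_seq_tail.
Qed.


(** The imaginary part of [e^{i be} exp (- e^{i psi} q^2)]: a Gaussian on a turned line. *)
Definition fresnel (psi be q : R) : R := exp (- cos psi * q ^ 2) * sin (be - sin psi * q ^ 2).

Lemma continuous_fresnel (psi be q : R) : continuous (fresnel psi be) q.
Proof. revert q; unfold fresnel; smooth. Qed.

(** The substitution [q = e^{s/2}] gives Euler's integral for [Gamma (1/2) = sqrt pi] on the ray of
    argument [psi]; its decay [exp (- s)] becomes the rate [1 / Q^2]. *)
Lemma fresnel_tail (psi be Q : R) : - (PI / 2) < psi < PI / 2 -> 0 < Q ->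
  Rabs (2 * RInt (fresnel psi be) 0 Q - sin (be - psi / 2) * sqrt PI)
    <= damping (/ 2) (cos psi) / Q ^ 2.
Proof.
  intros Hpsi HQ.
  assert (Hc : 0 < cos psi) by (apply cos_gt_0; lra).
  set (f := fun s => exp (/ 2 * s - cos psi * exp s) * sin (be - psi / 2 + / 2 * psi - sin psi * exp s)).
  assert (Hf : forall s, continuous f s) by (unfold f; smooth).
  assert (Ef : forall s, f s = exp (/ 2 * s) * fresnel psi be (exp (/ 2 * s))).
  { intros s; unfold f, fresnel.
    replace (exp (/ 2 * s) ^ 2) with (exp s) by (rewrite exp_pow; f_equal; simpl; field).
    rewrite -Rmult_assoc -exp_plus; f_equal; f_equal; field. }
  assert (HL := lim_int_gam_ray (/ 2) psi (be - psi / 2) ltac:(lra) Hpsi).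
  fold f in HL; rewrite gam_half in HL.
  set (L := sin (be - psi / 2) * sqrt PI) in *.
  set (B := 2 * ln Q).
  assert (EB : exp (/ 2 * B) = Q) by (unfold B; rewrite -Rmult_assoc Rinv_l ?Rmult_1_l ?exp_ln; lra).
  assert (Hth : forall x, 0 <= x -> Rabs (RInt (fresnel psi be) 0 x) <= x).
  { intros x Hx; replace x with ((x - 0) * 1) at 2 by ring.
    apply abs_RInt_le_const; auto.
    - apply ex_RInt_cont, continuous_fresnel.
    - intros t _; rewrite -exp_0; apply abs_exp_mul_le; [apply abs_sin_le_1 |].
      generalize (pow2_ge_0 t) (Rmult_le_pos (cos psi) (t ^ 2)); lra. }
  apply le_epsilon; intros eps Heps.
  (* The point [q = 0] lies at [s = - infinity], so the integral is cut at [q = eps / 4]: the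
     missing pieces of the two integrals cost [eps / 2] each. *)
  set (A := 2 * ln (eps / 4)).
  assert (EA : exp (/ 2 * A) = eps / 4)
    by (unfold A; rewrite -Rmult_assoc Rinv_l ?Rmult_1_l ?exp_ln; lra).
  assert (HT := lim_int_tail f (/ 2) 1 1 (damping (/ 2) (cos psi)) L ltac:(lra) ltac:(lra) Hf).
  assert (E : RInt f A B = 2 * RInt (fresnel psi be) 0 Q - 2 * RInt (fresnel psi be) 0 (eps / 4)).
  { rewrite -EA -EB.
    apply (RInt_of_derive (fun s => 2 * RInt (fresnel psi be) 0 (exp (/ 2 * s)))); auto.
    intros s.
    replace (f s) with (scal 2 (scal (/ 2 * exp (/ 2 * s)) (fresnel psi be (exp (/ 2 * s))))).
    - apply: is_derive_scal.
      apply (is_derive_comp (fun x => RInt (fresnel psi be) 0 x) (fun s => exp (/ 2 * s))).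
      + apply is_derive_RInt_cont, continuous_fresnel.
      + auto_derive; auto; ring.
    - rewrite Ef; unfold scal; simpl; unfold mult; simpl; field. }
  assert (HT' : Rabs (RInt f A B - L) <= 1 / / 2 * exp (/ 2 * A) + damping (/ 2) (cos psi) / 1 * exp (- 1 * B)).
  { apply HT; auto.
    - intros s; apply (damped_le_left (/ 2) (cos psi)); try lra; apply abs_sin_le_1.
    - intros s; apply (damped_le_right (/ 2) (cos psi)); try lra; apply abs_sin_le_1. }
  rewrite E EA in HT'.
  replace (exp (- 1 * B)) with (/ Q ^ 2) in HT'.
  2:{ replace (- 1 * B) with (- (INR 2 * ln Q)) by (unfold B; simpl; ring).
      rewrite exp_Ropp -exp_pow exp_ln; auto. }
  replace (1 / / 2 * (eps / 4)) with (eps / 2) in HT' by field.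
  assert (H4 := Hth (eps / 4) ltac:(lra)).
  replace (2 * RInt (fresnel psi be) 0 Q - L) with
    ((2 * RInt (fresnel psi be) 0 Q - 2 * RInt (fresnel psi be) 0 (eps / 4) - L)
     + 2 * RInt (fresnel psi be) 0 (eps / 4)) by (toR; ring).
  eapply Rle_trans; [apply Rabs_triang |].
  rewrite (Rabs_mult 2) (Rabs_pos_eq 2); [| lra].
  unfold Rdiv in *; rewrite ?Rinv_1 ?Rmult_1_r in HT'; lra.
Qed.

(* Folding [s] and [- s] together and substituting [q = e^{w/2} (e^{s/2} - e^{-s/2})]. *)
Lemma fresnel_fold (w psi be B : R) :
  RInt (fun s => exp (/ 2 * s) * fresnel psi be (exp (w / 2) * (exp (/ 2 * s) - exp (- / 2 * s))))
    (- B) B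
  = 2 * exp (- (w / 2)) *
    RInt (fresnel psi be) 0 (exp (w / 2) * (exp (/ 2 * B) - exp (- / 2 * B))).
Proof.
  set (q := fun s => exp (w / 2) * (exp (/ 2 * s) - exp (- / 2 * s))).
  set (f := fun s => exp (/ 2 * s) * fresnel psi be (q s)).
  assert (Hf : forall s, continuous f s) by (unfold f, q, fresnel; smooth).
  assert (Hq : forall s, fresnel psi be (q (- s)) = fresnel psi be (q s)).
  { intros s; unfold fresnel; replace (q (- s) ^ 2) with (q s ^ 2); auto.
    unfold q; replace (/ 2 * - s) with (- / 2 * s) by field.
    replace (- / 2 * - s) with (/ 2 * s) by field; ring. }
  change (RInt f (- B) B = 2 * exp (- (w / 2)) * RInt (fresnel psi be) 0 (q B)).
  replace (RInt f (- B) B) with (RInt f 0 B - RInt f 0 (- B)).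
  2:{ rewrite <- (RInt_Chasles_cont f 0 (- B) B) by auto; toR; ring. }
  apply (eq_of_derive_eq (fun B => RInt f 0 B - RInt f 0 (- B))
    (fun B => 2 * exp (- (w / 2)) * RInt (fresnel psi be) 0 (q B))
    (fun B => (exp (/ 2 * B) + exp (- / 2 * B)) * fresnel psi be (q B)) 0 B).
  - intros s.
    replace ((exp (/ 2 * s) + exp (- / 2 * s)) * fresnel psi be (q s))
      with (minus (f s) (scal (-1) (f (- s)))).
    + apply: is_derive_minus; [now apply is_derive_RInt_cont |].
      apply (is_derive_comp (fun x => RInt f 0 x) (fun s => - s)).
      * now apply is_derive_RInt_cont.
      * auto_derive; auto; ring.
    + unfold f; rewrite Hq; replace (/ 2 * - s) with (- / 2 * s) by field.
      unfold minus, plus, opp, scal; simpl; unfold mult; simpl; ring.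
  - intros s.
    replace ((exp (/ 2 * s) + exp (- / 2 * s)) * fresnel psi be (q s))
      with (scal (2 * exp (- (w / 2)))
        (scal (exp (w / 2) * (/ 2 * exp (/ 2 * s) + / 2 * exp (- / 2 * s))) (fresnel psi be (q s)))).
    + apply: is_derive_scal.
      apply (is_derive_comp (fun x => RInt (fresnel psi be) 0 x) q).
      * apply is_derive_RInt_cont, continuous_fresnel.
      * unfold q; auto_derive; auto; field.
    + unfold scal; simpl; unfold mult; simpl.
      assert (H : exp (- (w / 2)) * exp (w / 2) = 1) by (rewrite -exp_plus Rplus_opp_l exp_0; auto).
      transitivity ((exp (- (w / 2)) * exp (w / 2)) *
        ((exp (/ 2 * s) + exp (- / 2 * s)) * fresnel psi be (q s))); [field | rewrite H; ring].
  - assert (H0 : q 0 = 0) by (unfold q; rewrite !Rmult_0_r Rminus_diag Rmult_0_r; auto).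
    rewrite H0 Ropp_0 !RInt_point; unfold zero; simpl; ring.
Qed.

Lemma lim_int_fresnel_fold (w psi be : R) : - (PI / 2) < psi < PI / 2 ->
  lim_int (fun s => exp (/ 2 * s) * fresnel psi be (exp (w / 2) * (exp (/ 2 * s) - exp (- / 2 * s))))
    (exp (- (w / 2)) * (sin (be - psi / 2) * sqrt PI)).
Proof.
  intros Hpsi.
  set (q := fun s => exp (w / 2) * (exp (/ 2 * s) - exp (- / 2 * s))).
  set (L := sin (be - psi / 2) * sqrt PI).
  apply is_lim_seq_ext with (u := fun n => exp (- (w / 2)) *
     (L + (2 * RInt (fresnel psi be) 0 (q (INR n)) - L))).
  { intros n; rewrite fresnel_fold; fold (q (INR n)); toR; ring. }
  apply (is_lim_seq_scal_l _ (exp (- (w / 2))) L).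
  replace (Finite L) with (Finite (L + 0)) by (f_equal; ring).
  apply is_lim_seq_plus'; [apply is_lim_seq_const |].
  apply is_lim_seq_abs_0.
  set (D := damping (/ 2) (cos psi)).
  apply (is_lim_seq_le_le_loc (fun _ => 0) _ (fun n => D * 4 / exp w * / INR n)).
  - exists 1%nat; intros n Hn.
    assert (H1 : 1 <= INR n) by (apply le_INR in Hn; exact Hn).
    split; [apply Rabs_pos |].
    assert (Hq : exp (w / 2) * (INR n / 2) <= q (INR n)).
    { unfold q; apply Rmult_le_compat_l; [apply Rlt_le, exp_pos |].
      generalize (exp_ge_tangent (/ 2 * INR n)); intros H.
      assert (exp (- / 2 * INR n) <= 1); [| lra].
      rewrite -exp_0; apply exp_le; lra. }
    assert (Hp : 0 < exp (w / 2) * (INR n / 2)).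
    { apply Rmult_lt_0_compat; [apply exp_pos | lra]. }
    eapply Rle_trans; [apply fresnel_tail; auto; lra |]; fold D.
    assert (HD : 0 <= D) by apply Rlt_le, exp_pos.
    assert (Hw := exp_pos w).
    replace (D * 4 / exp w * / INR n) with (D * / (exp w * INR n / 4)).
    2:{ field; lra. }
    apply Rmult_le_compat_l; auto.
    apply Rinv_le_contravar.
    + apply Rmult_lt_0_compat; [| lra]; apply Rmult_lt_0_compat; lra.
    + apply Rle_trans with ((exp (w / 2) * (INR n / 2)) ^ 2).
      * rewrite Rpow_mult_distr exp_pow.
        replace (INR 2 * (w / 2)) with w by (simpl; field).
        replace (exp w * INR n / 4) with (exp w * (INR n / 4)) by field.
        apply Rmult_le_compat_l; [lra | nra].
      * apply pow_incr; lra.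
  - apply is_lim_seq_const.
  - replace (Finite 0) with (Finite (D * 4 / exp w * 0)) by (f_equal; ring).
    apply (is_lim_seq_scal_l _ _ 0), is_lim_seq_inv_INR.
Qed.

Lemma exp_half_sq (s : R) : exp s = exp (/ 2 * s) * exp (/ 2 * s).
Proof. rewrite -exp_plus; f_equal; field. Qed.

(* The contour is first rotated by [psi], which makes the two exponentials conjugate to one
   another up to a common phase. *)
Lemma lim_int_gauss_balanced (w psi be : R) : 0 <= psi < PI / 4 ->
  lim_int (fun s => exp (/ 2 * s - exp w * exp (- s) - exp w * cos (2 * psi) * exp s)
                    * sin (be - exp w * sin (2 * psi) * exp s))
    (exp (- (w / 2)) * exp (- (2 * exp w * cos psi))
     * (sin (be - psi - 2 * exp w * sin psi) * sqrt PI)).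
Proof.
  intros Hpsi.
  assert (Hw := exp_pos w).
  assert (Hc : 0 < cos (2 * psi)) by (apply cos_gt_0; lra).
  (* [Y] and [X] are the logarithm of the modulus and the phase of the integrand at [s - i th]. At
     [th = psi] both exponentials carry the factor [e^{i psi}], and [e^s + e^{-s} = (e^{s/2} -
     e^{-s/2})^2 + 2] completes the square: the square gives a [fresnel] integrand, the [2] a
     constant factor. *)
  set (X := fun th s => be - / 2 * th - exp w * sin th * exp (- s) - exp w * sin (2 * psi - th) * exp s).
  set (Y := fun th s => / 2 * s - exp w * cos th * exp (- s) - exp w * cos (2 * psi - th) * exp s).
  assert (Bd : forall th s, 0 <= th <= psi ->
     Y th s <= / 2 * s - exp w * cos (2 * psi) * exp s).
  { intros th s Hth; unfold Y.
    assert (0 <= exp w * cos th * exp (- s)).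
    { repeat apply Rmult_le_pos; try (apply Rlt_le, exp_pos); apply cos_ge_0; lra. }
    assert (exp w * cos (2 * psi) * exp s <= exp w * cos (2 * psi - th) * exp s); [| lra].
    apply Rmult_le_compat_r; [apply Rlt_le, exp_pos |].
    apply Rmult_le_compat_l; [lra |].
    apply cos_decr_1; lra. }
  assert (E0 : forall s, exp (Y 0 s) * sin (X 0 s) =
     exp (/ 2 * s - exp w * exp (- s) - exp w * cos (2 * psi) * exp s)
                    * sin (be - exp w * sin (2 * psi) * exp s)).
  { intros s; unfold X, Y; rewrite sin_0 cos_0 !Rminus_0_r !Rmult_0_r !Rmult_0_l Rmult_1_r !Rminus_0_r; auto. }
  apply lim_int_ext with (1 := E0).
  assert (Hpos : 0 < exp w * cos (2 * psi)) by now apply Rmult_lt_0_compat.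
  apply (lim_int_shift (fun th s => exp (Y th s) * sin (X th s))
    (fun th s => - (exp (Y th s) * cos (X th s)))
    (fun th s => exp (Y th s) *
      ((exp w * sin th * exp (- s) - exp w * sin (2 * psi - th) * exp s) * sin (X th s)
       + (- / 2 - exp w * cos th * exp (- s) + exp w * cos (2 * psi - th) * exp s) * cos (X th s)))
    (/ 2) 1 1 (damping (/ 2) (exp w * cos (2 * psi))) psi 0); try lra.
  - intros th s; unfold X, Y; auto_derive; auto; unfold Rminus; field.
  - intros th s; unfold X, Y; auto_derive; auto; unfold Rminus; field.
  - unfold X, Y; smooth.
  - unfold X, Y; smooth2.
  - intros th s; rewrite Rmin_right; [| lra]; rewrite Rmax_left; [| lra]; intros Hth.
    rewrite Rabs_Ropp Rmult_1_l; apply abs_exp_mul_le; [apply abs_cos_le_1 |].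
    apply Rle_trans with (1 := Bd th s Hth).
    assert (0 <= exp w * cos (2 * psi) * exp s); [| lra].
    apply Rmult_le_pos; [lra | apply Rlt_le, exp_pos].
  - intros th s; rewrite Rmin_right; [| lra]; rewrite Rmax_left; [| lra]; intros Hth.
    rewrite Rabs_Ropp.
    apply Rle_trans with (exp (/ 2 * s - exp w * cos (2 * psi) * exp s)).
    + apply abs_exp_mul_le; [apply abs_cos_le_1 | auto].
    + apply exp_damped_le; lra.
  - set (be1 := be - psi / 2 - 2 * exp w * sin psi).
    apply lim_int_ext with (f := fun s => exp (- (2 * exp w * cos psi)) *
       (exp (/ 2 * s) * fresnel psi be1 (exp (w / 2) * (exp (/ 2 * s) - exp (- / 2 * s))))).
    + intros s; unfold fresnel.
      replace ((exp (w / 2) * (exp (/ 2 * s) - exp (- / 2 * s))) ^ 2)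
        with (exp w * (exp s + exp (- s) - 2)).
      * rewrite -!Rmult_assoc -!exp_plus; unfold X, Y, be1.
        replace (2 * psi - psi) with psi by ring.
        f_equal; f_equal; field.
      * rewrite (exp_half_sq w) (exp_half_sq s) (exp_half_sq (- s)).
        replace (w / 2) with (/ 2 * w) by field.
        replace (/ 2 * - s) with (- / 2 * s) by field.
        assert (H : exp (/ 2 * s) * exp (- / 2 * s) = 1).
        { rewrite -exp_plus -exp_0; f_equal; ring. }
        transitivity (exp (/ 2 * w) * exp (/ 2 * w) *
          (exp (/ 2 * s) * exp (/ 2 * s) + exp (- / 2 * s) * exp (- / 2 * s)
           - 2 * (exp (/ 2 * s) * exp (- / 2 * s)))); [rewrite H |]; ring.
    + replace (exp (- (w / 2)) * exp (- (2 * exp w * cos psi))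
        * (sin (be - psi - 2 * exp w * sin psi) * sqrt PI))
      with (exp (- (2 * exp w * cos psi)) * (exp (- (w / 2)) * (sin (be1 - psi / 2) * sqrt PI))).
      * apply lim_int_scal; [unfold fresnel; smooth |].
        apply lim_int_fresnel_fold; lra.
      * replace (be1 - psi / 2) with (be - psi - 2 * exp w * sin psi) by (unfold be1; field).
        ring.
Qed.

Definition gauss_osc (b psi u be tau : R) : R :=
  exp (/ 2 * tau - b ^ 2 * exp (- tau) - cos (2 * psi) * exp (2 * u + tau))
  * sin (be - sin (2 * psi) * exp (2 * u + tau)).

Lemma continuous_gauss_osc (b psi u be tau : R) : continuous (gauss_osc b psi u be) tau.
Proof. revert tau; unfold gauss_osc; smooth. Qed.

(* [int (pi y)^{-1/2} exp (- b^2 / y - p y) dy = p^{-1/2} exp (- 2 b p^{1/2})] for the complex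
   parameter [p = e^{2 (u + i psi)}], with [y = e^tau]. *)
Lemma lim_int_gauss_osc (b psi u be : R) : 0 <= b -> 0 <= psi < PI / 4 ->
  lim_int (gauss_osc b psi u be)
    (sqrt PI * exp (- u) * exp (- (2 * b * exp u * cos psi))
     * sin (be - psi - 2 * b * exp u * sin psi)).
Proof.
  intros [Hb|Hb] Hpsi.
  (* With [b = e^v], the shift of [tau] by [u - v] gives [b^2 e^{- tau}] and [e^{2 u + tau}] the
     same coefficient [e^{u + v}], which is the balanced case. *)
  - set (v := ln b).
    assert (Ev : b = exp v) by (unfold v; rewrite exp_ln; auto).
    assert (Hc : 0 < cos (2 * psi)) by (apply cos_gt_0; lra).
    set (g := fun s => exp (/ 2 * s - exp (u + v) * exp (- s) - exp (u + v) * cos (2 * psi) * exp s)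
                    * sin (be - exp (u + v) * sin (2 * psi) * exp s)).
    assert (Hg := lim_int_gauss_balanced (u + v) psi be Hpsi); fold g in Hg.
    assert (Hw := exp_pos (u + v)).
    apply (lim_int_translate g (/ 2) 1 1 (damping (/ 2) (exp (u + v) * cos (2 * psi))) _ (u - v)) in Hg;
      try lra.
    + apply lim_int_ext with (f := fun s => exp (- / 2 * (u - v)) * g (s + (u - v))).
      * intros s; unfold g, gauss_osc.
        rewrite -Rmult_assoc -exp_plus.
        assert (E1 : exp (u + v) * exp (- (s + (u - v))) = b ^ 2 * exp (- s)).
        { rewrite Ev exp_pow -!exp_plus; f_equal; simpl; ring. }
        assert (E2 : exp (u + v) * exp (s + (u - v)) = exp (2 * u + s)).
        { rewrite -exp_plus; f_equal; ring. }
        rewrite E1.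
        replace (exp (u + v) * cos (2 * psi) * exp (s + (u - v)))
          with (cos (2 * psi) * exp (2 * u + s)) by (rewrite -E2; ring).
        replace (exp (u + v) * sin (2 * psi) * exp (s + (u - v)))
          with (sin (2 * psi) * exp (2 * u + s)) by (rewrite -E2; ring).
        f_equal; f_equal; field.
      * replace (sqrt PI * exp (- u) * exp (- (2 * b * exp u * cos psi))
           * sin (be - psi - 2 * b * exp u * sin psi))
        with (exp (- / 2 * (u - v)) * (exp (- ((u + v) / 2)) * exp (- (2 * exp (u + v) * cos psi))
           * (sin (be - psi - 2 * exp (u + v) * sin psi) * sqrt PI))).
        -- apply lim_int_scal; [unfold g; smooth | auto].
        -- replace (2 * b * exp u) with (2 * exp (u + v)) by (rewrite exp_plus Ev; ring).
           replace (exp (- u)) with (exp (- / 2 * (u - v)) * exp (- ((u + v) / 2)))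
             by (rewrite -exp_plus; f_equal; field).
           ring.
    + unfold g; smooth.
    + intros s; unfold g; rewrite Rmult_1_l; apply abs_exp_mul_le; [apply abs_sin_le_1 |].
      assert (0 <= exp (u + v) * exp (- s)) by (apply Rmult_le_pos; apply Rlt_le, exp_pos).
      assert (0 <= exp (u + v) * cos (2 * psi) * exp s); [| lra].
      repeat apply Rmult_le_pos; try lra; apply Rlt_le, exp_pos.
    + intros s; apply Rle_trans with (exp (/ 2 * s - exp (u + v) * cos (2 * psi) * exp s)).
      * unfold g; apply abs_exp_mul_le; [apply abs_sin_le_1 |].
        assert (0 <= exp (u + v) * exp (- s)) by (apply Rmult_le_pos; apply Rlt_le, exp_pos).
        lra.
      * apply exp_damped_le; [lra | now apply Rmult_lt_0_compat].
  (* For [b = 0], that is [x = 0], nothing can be balanced; the integral is [Gamma (1/2)] on the ray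
     of argument [2 psi]. *)
  - assert (Hc : 0 < cos (2 * psi)) by (apply cos_gt_0; lra).
    set (g := fun s => exp (/ 2 * s - cos (2 * psi) * exp s)
                * sin (be - psi + / 2 * (2 * psi) - sin (2 * psi) * exp s)).
    assert (Hg := lim_int_gam_ray (/ 2) (2 * psi) (be - psi) ltac:(lra) ltac:(lra)); fold g in Hg.
    apply (lim_int_translate g (/ 2) 1 1 (damping (/ 2) (cos (2 * psi))) _ (2 * u)) in Hg; try lra.
    + apply lim_int_ext with (f := fun s => exp (- u) * g (s + 2 * u)).
      * intros s; unfold g, gauss_osc; rewrite -Hb.
        rewrite -Rmult_assoc -exp_plus (Rplus_comm s).
        f_equal; f_equal; field.
      * rewrite gam_half in Hg.
        replace (sqrt PI * exp (- u) * _ * _) with (exp (- u) * (sin (be - psi) * sqrt PI)).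
        -- apply lim_int_scal; [unfold g; smooth | auto].
        -- rewrite -Hb !Rmult_0_r !Rmult_0_l Ropp_0 exp_0 Rminus_0_r; ring.
    + unfold g; smooth.
    + intros s; apply (damped_le_left (/ 2) (cos (2 * psi))); try lra; apply abs_sin_le_1.
    + intros s; apply (damped_le_right (/ 2) (cos (2 * psi))); try lra; apply abs_sin_le_1.
Qed.

(** * Subordination *)

Definition wright (mu y : R) : R := Series (wright_term mu y).

(** The angles [phi] and [nu phi] add up to [pi] and are unequal because [nu < 1], so [pi / 2] lies
    strictly between them. *)
Lemma hankel_angle (nu : R) : 0 < nu < 1 ->
  PI / 2 < PI / (1 + nu) < PI /\ 0 < nu * (PI / (1 + nu)) < PI / 2.
Proof.
  intros Hnu; generalize PI_RGT_0; intros HP.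
  set (phi := PI / (1 + nu)).
  assert (E : phi * (1 + nu) = PI) by (unfold phi; field; lra).
  assert (H0 : 0 < phi) by (apply Rdiv_lt_0_compat; lra).
  repeat split; nra.
Qed.

Lemma ex_series_wright_term (mu : R) : 0 < mu < 1 ->
  forall y, 0 <= y -> ex_series (wright_term mu y).
Proof.
  intros Hmu y Hy.
  destruct (hankel_angle mu Hmu) as [Hphi Hm].
  apply (hankel_series mu (PI / (1 + mu)) y); auto.
  apply cos_gt_0; lra.
Qed.

(** Convergence at every nonnegative point, supplied by Hankel's integral, forces an infinite
    radius: outside the disk of convergence the terms could not tend to zero. *)
Lemma continuous_wright (mu y : R) : 0 < mu < 1 -> continuous (wright mu) y.
Proof.
  intros Hmu.
  set (a := fun k => (-1) ^ k / INR (Factorial.fact k) * rgamma (1 - mu * INR (S k))).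
  assert (E : forall y k, a k * y ^ k = wright_term mu y k).
  { intros z k; unfold a, wright_term.
    replace (- z) with (-1 * z) by ring; rewrite Rpow_mult_distr; unfold Rdiv; ring. }
  apply continuous_ext with (f := PSeries a).
  { intros z; apply Series_ext; intros k; apply E. }
  apply continuity_pt_filterlim, PSeries_continuity.
  apply Rbar_not_le_lt; intros H.
  assert (H1 : 0 <= Rabs y + 1) by (generalize (Rabs_pos y); lra).
  apply (CV_disk_outside a (Rabs y + 1)).
  - apply Rbar_le_lt_trans with (1 := H); simpl; rewrite (Rabs_pos_eq (Rabs y + 1)); lra.
  - apply is_lim_seq_ext with (1 := fun k => eq_sym (E (Rabs y + 1) k)).
    now apply ex_series_lim_0, ex_series_wright_term.
Qed.

Lemma abs_RInt_le_sum (f : R -> R) (a C d D A B : R) : 0 < a -> 0 < d -> A <= 0 <= B ->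
  (forall s, continuous f s) ->
  (forall s, Rabs (f s) <= C * exp (a * s)) -> (forall s, Rabs (f s) <= D * exp (- d * s)) ->
  Rabs (RInt f A B) <= C / a + D / d.
Proof.
  intros Ha Hd HAB Hf HC HD.
  rewrite <- (RInt_Chasles_cont f A 0 B) by auto.
  generalize (abs_RInt_left f a C A 0 Ha ltac:(lra) Hf HC)
    (abs_RInt_right f d D 0 B Hd ltac:(lra) Hf HD).
  rewrite !Rmult_0_r exp_0 !Rmult_1_r; intros H1 H2.
  apply Rle_trans with (1 := Rabs_triang _ _); lra.
Qed.

Lemma RInt_damped_bound (a c : R) (n : nat) : 0 < a -> 0 < c ->
  RInt (fun s => exp (a * s - c * exp s)) (- INR n) (INR n) <= 1 / a + damping a c / 1.
Proof.
  intros Ha Hc; generalize (pos_INR n); intros Hn.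
  apply Rle_trans with (1 := Rle_abs _).
  apply abs_RInt_le_sum; try lra.
  - smooth.
  - intros s; generalize (damped_le_left a c c s 1); rewrite Rabs_R1 Rmult_1_r; intros H; apply H; lra.
  - intros s; generalize (damped_le_right a c c s 1); rewrite Rabs_R1 Rmult_1_r; intros H; apply H; lra.
Qed.

(** The weight [k = 3 / 4] is the midpoint of its admissible range. The right tail is
    [exp (- 2 k u) exp (- (k - 1/2) B)]: decay in [B] asks for [k > 1/2], and with [u = nu s / 2]
    the product with [exp (nu s)] stays integrable as [s] tends to [- infinity] only for [k < 1]. *)
Lemma gauss_osc_tail (b psi u be A B : R) : 0 <= b -> 0 <= psi < PI / 4 ->
  Rabs (RInt (gauss_osc b psi u be) A B
        - sqrt PI * exp (- u) * exp (- (2 * b * exp u * cos psi))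
          * sin (be - psi - 2 * b * exp u * sin psi))
  <= 2 * exp (/ 2 * A)
     + 4 * exp (3 / 4 * ln (3 / 4 / cos (2 * psi)) - 3 / 4) * exp (- (3 / 2) * u) * exp (- / 4 * B).
Proof.
  intros Hb Hpsi.
  assert (Hc : 0 < cos (2 * psi)) by (apply cos_gt_0; lra).
  assert (Hb2 : forall s, 0 <= b ^ 2 * exp (- s)).
  { intros s; apply Rmult_le_pos; [apply pow2_ge_0 | apply Rlt_le, exp_pos]. }
  assert (Hcs : forall s, 0 <= cos (2 * psi) * exp (2 * u + s)).
  { intros s; apply Rmult_le_pos; [lra | apply Rlt_le, exp_pos]. }
  set (D := exp (3 / 4 * ln (3 / 4 / cos (2 * psi)) - 3 / 4)).
  eapply Rle_trans.
  - apply (lim_int_tail (gauss_osc b psi u be) (/ 2) 1 (/ 4) (D * exp (- (3 / 2) * u))); try lra.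
    + apply continuous_gauss_osc.
    + intros s; rewrite Rmult_1_l; apply abs_exp_mul_le; [apply abs_sin_le_1 |].
      generalize (Hb2 s) (Hcs s); lra.
    + intros s.
      apply Rle_trans with (exp ((3 / 4 * (2 * u + s) - cos (2 * psi) * exp (2 * u + s))
                                 + (- (3 / 2) * u + - / 4 * s))).
      * apply abs_exp_mul_le; [apply abs_sin_le_1 |].
        generalize (Hb2 s); lra.
      * rewrite (exp_plus (_ - _)) (exp_plus (- (3 / 2) * u)) -Rmult_assoc.
        apply Rmult_le_compat_r; [apply Rlt_le, exp_pos |].
        apply Rmult_le_compat_r; [apply Rlt_le, exp_pos |].
        unfold D; apply exp_sub_exp_le; lra.
    + now apply lim_int_gauss_osc.
  - right; field.
Qed.

(* Here [w = lam t^nu e^tau] and [xi = |x| / (lam t^{nu/2})]. *)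
Lemma wright_subordination (nu xi : R) : 0 < nu < 1 -> 0 <= xi ->
  exists C, forall A B, A <= B ->
  Rabs (RInt (fun tau => exp (/ 2 * tau - (xi / 2) ^ 2 * exp (- tau)) * wright nu (exp tau)) A B
        - sqrt PI * wright (nu / 2) xi) <= C * (exp (/ 2 * A) + exp (- / 4 * B)).
Proof.
  intros Hnu Hxi; generalize PI_RGT_0; intros HP.
  destruct (hankel_angle nu Hnu) as [Hphi Hg].
  set (phi := PI / (1 + nu)) in *; set (gm := nu * phi) in *; set (b := xi / 2).
  assert (Hc : cos phi < 0) by (apply cos_lt_0; lra).
  assert (Hcg : 0 < cos gm) by (apply cos_gt_0; lra).
  set (D := exp (3 / 4 * ln (3 / 4 / cos (2 * (gm / 2))) - 3 / 4)).
  set (G1 := 1 / nu + damping nu (- cos phi) / 1).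
  set (G2 := 1 / (nu / 4) + damping (nu / 4) (- cos phi) / 1).
  set (g := fun tau => exp (/ 2 * tau - b ^ 2 * exp (- tau))).
  assert (Hgc : forall s, continuous g s) by (unfold g; smooth).
  assert (Hwc : forall s, continuous (fun tau => wright nu (exp tau)) s).
  { intros s; apply (continuous_comp exp (wright nu)); [apply continuous_exp | now apply continuous_wright]. }
  exists ((2 * G1 + 4 * D * G2) / PI); intros A B HAB.
  change (Rabs (RInt (fun tau => g tau * wright nu (exp tau)) A B - sqrt PI * wright (nu / 2) xi)
    <= (2 * G1 + 4 * D * G2) / PI * (exp (/ 2 * A) + exp (- / 4 * B))).
  set (I := RInt (fun tau => g tau * wright nu (exp tau)) A B).
  assert (HD : 0 < D) by apply exp_pos.
  assert (HG1 : 0 < G1).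
  { apply Rplus_lt_0_compat; apply Rdiv_lt_0_compat; try lra; apply exp_pos. }
  assert (HG2 : 0 < G2).
  { apply Rplus_lt_0_compat; apply Rdiv_lt_0_compat; try lra; apply exp_pos. }
  set (K := fun s tau => g tau * hankel nu phi (exp tau) s).
  assert (HK : continuous2 K) by (unfold K, g, hankel; smooth2).
  assert (HKt : forall s tau, continuous (fun tau => K s tau) tau) by (intros; now apply continuous2_r).
  assert (HKs : forall s tau, continuous (fun s => K s tau) s).
  { intros; now apply (continuous2_l K). }
  (* At a contour point [z] the integral over [tau] is the Gaussian one at [p = z^nu], that is
     [u = nu s / 2] and [psi = gm / 2], which is below [pi / 4] as required. *)
  assert (Hin : forall s, RInt (fun tau => K s tau) A B
      = exp (nu * s - - cos phi * exp s)
        * RInt (gauss_osc b (gm / 2) (nu * s / 2) (gm + sin phi * exp s)) A B).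
  { intros s; rewrite <- RInt_scal_cont by apply continuous_gauss_osc.
    apply RInt_ext; intros tau _; unfold K, g, hankel, gauss_osc; fold gm.
    replace (2 * (gm / 2)) with gm by field.
    replace (2 * (nu * s / 2) + tau) with (tau + nu * s) by field.
    rewrite (exp_plus tau) -!Rmult_assoc -!exp_plus.
    f_equal; f_equal; ring. }
  (* The factor [p^{-1/2}] lowers [z^nu] to [z^{nu/2}] and [exp (- xi p^{1/2})] supplies the
     exponential of the Hankel integrand of index [nu / 2]. *)
  assert (Hhk : forall s, exp (nu * s - - cos phi * exp s) *
     (sqrt PI * exp (- (nu * s / 2)) * exp (- (2 * b * exp (nu * s / 2) * cos (gm / 2)))
          * sin (gm + sin phi * exp s - gm / 2 - 2 * b * exp (nu * s / 2) * sin (gm / 2)))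
     = sqrt PI * hankel (nu / 2) phi xi s).
  { intros s; unfold hankel.
    replace (nu / 2 * phi) with (gm / 2) by (unfold gm; field).
    replace (nu * s / 2) with (nu / 2 * s) by field.
    replace (2 * b) with xi by (unfold b; field).
    replace (gm + sin phi * exp s - gm / 2 - xi * exp (nu / 2 * s) * sin (gm / 2))
      with (gm / 2 + sin phi * exp s - xi * sin (gm / 2) * exp (nu / 2 * s)) by field.
    replace (nu / 2 * s + cos phi * exp s - xi * cos (gm / 2) * exp (nu / 2 * s))
      with ((nu * s - - cos phi * exp s) + - (nu / 2 * s) + - (xi * exp (nu / 2 * s) * cos (gm / 2)))
      by field.
    rewrite (exp_plus (_ + _)) (exp_plus (_ - _)); ring. }
  (* The error of cutting [tau] to [[A, B]] is integrated over the contour: the left tail meets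
     [exp (nu s)], the right one [exp (nu s / 4)], both integrable, whence a bound independent of
     [n]. *)
  assert (Hout : forall n,
    Rabs (RInt (fun s => RInt (fun tau => K s tau) A B) (- INR n) (INR n)
      - sqrt PI * RInt (hankel (nu / 2) phi xi) (- INR n) (INR n))
    <= 2 * exp (/ 2 * A) * G1 + 4 * D * exp (- / 4 * B) * G2).
  { intros n.
    assert (Hc1 : forall s, continuous (fun s => RInt (fun tau => K s tau) A B) s).
    { intros; now apply continuous_RInt_param. }
    assert (Hc2 : forall s, continuous (fun s => sqrt PI * hankel (nu / 2) phi xi s) s).
    { intros; apply (continuous_mult (fun _ => sqrt PI)); [apply continuous_const | apply continuous_hankel]. }
    rewrite <- RInt_scal_cont by apply continuous_hankel.
    rewrite <- RInt_minus_cont by auto.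
    apply Rle_trans with (RInt (fun s => 2 * exp (/ 2 * A) * exp (nu * s - - cos phi * exp s)
       + 4 * D * exp (- / 4 * B) * exp (nu / 4 * s - - cos phi * exp s)) (- INR n) (INR n)).
    - apply abs_RInt_le_cont.
      + generalize (pos_INR n); lra.
      + intros; apply: continuous_minus; auto.
      + smooth.
      + intros s; rewrite Hin -Hhk -Rmult_minus_distr_l Rabs_mult (Rabs_pos_eq (exp _));
          [| apply Rlt_le, exp_pos].
        eapply Rle_trans.
        * apply Rmult_le_compat_l; [apply Rlt_le, exp_pos |].
          apply gauss_osc_tail; unfold b; lra.
        * right; fold D.
          replace (nu / 4 * s - - cos phi * exp s) with
            ((nu * s - - cos phi * exp s) + - (3 / 2) * (nu * s / 2)) by field.
          rewrite (exp_plus (nu * s - - cos phi * exp s)); ring.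
    - rewrite RInt_plus_cont; try smooth.
      rewrite !RInt_scal_cont; try smooth.
      apply Rplus_le_compat.
      + apply Rmult_le_compat_l; [| apply RInt_damped_bound; lra].
        generalize (exp_pos (/ 2 * A)); lra.
      + apply Rmult_le_compat_l; [| apply RInt_damped_bound; lra].
        apply Rmult_le_pos; [lra | apply Rlt_le, exp_pos]. }
  (* The tail bounds on [hankel] do not involve [y], so for fixed [A] and [B] the contour integrals
     converge uniformly over [tau] in [[A, B]] and the limit passes through the outer integral. *)
  assert (Hlim1 : is_lim_seq (fun n => RInt (fun s => RInt (fun tau => K s tau) A B) (- INR n) (INR n))
                    (PI * I)).
  { apply is_lim_seq_ext with (u := fun n => PI * I +
      (RInt (fun tau => RInt (fun s => K s tau) (- INR n) (INR n)) A B - PI * I)).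
    { intros n; rewrite Rplus_minus; now apply RInt_Fubini. }
    replace (Finite (PI * I)) with (Finite (PI * I + 0)) by (f_equal; ring).
    apply is_lim_seq_plus'; [apply is_lim_seq_const |].
    apply is_lim_seq_abs_0.
    set (E := damping nu (- cos phi)).
    apply is_lim_seq_le_le with (u := fun _ => 0)
      (w := fun n => ((B - A) * exp (/ 2 * B)) * (1 / nu * exp (nu * - INR n) + E / 1 * exp (- 1 * INR n))).
    - intros n; split; [apply Rabs_pos |].
      unfold I; rewrite <- RInt_scal_cont.
      2:{ intros s; apply (continuous_mult g); auto. }
      assert (Hc1 : forall s, continuous (fun tau => RInt (fun s => K s tau) (- INR n) (INR n)) s).
      { intros s; apply (continuous_RInt_param (fun tau s => K s tau)).
        - generalize (pos_INR n); lra.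
        - now apply continuous2_swap. }
      assert (Hc2 : forall s, continuous (fun tau => PI * (g tau * wright nu (exp tau))) s).
      { intros s; apply (continuous_mult (fun _ => PI)); [apply continuous_const |].
        apply (continuous_mult g); auto. }
      rewrite <- RInt_minus_cont by auto.
      rewrite (Rmult_assoc (B - A)).
      apply abs_RInt_le_const; auto.
      { apply ex_RInt_cont; intros; apply: continuous_minus; auto. }
      intros tau Htau.
      unfold K; rewrite RInt_scal_cont; [| apply continuous_hankel].
      replace (g tau * RInt (hankel nu phi (exp tau)) (- INR n) (INR n)
               - PI * (g tau * wright nu (exp tau)))
        with (g tau * (RInt (hankel nu phi (exp tau)) (- INR n) (INR n) - PI * wright nu (exp tau)))
        by (toR; ring).
      assert (He := exp_pos tau).
      apply Rle_trans with (Rabs (g tau) * Rabs (RInt (hankel nu phi (exp tau)) (- INR n) (INR n)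
         - PI * wright nu (exp tau))); [right; apply Rabs_mult |].
      apply Rmult_le_compat; try apply Rabs_pos.
      + unfold g; rewrite Rabs_pos_eq; [| apply Rlt_le, exp_pos].
        apply exp_le.
        assert (0 <= b ^ 2 * exp (- tau)); [| lra].
        apply Rmult_le_pos; [apply pow2_ge_0 | apply Rlt_le, exp_pos].
      + apply (lim_int_tail (hankel nu phi (exp tau)) nu 1 1 E); try lra.
        * apply continuous_hankel.
        * intros s; apply hankel_le_left; fold gm; lra.
        * intros s; apply hankel_le_right; fold gm; lra.
        * apply hankel_series; fold gm; lra.
    - apply is_lim_seq_const.
    - replace (Finite 0) with (Finite ((B - A) * exp (/ 2 * B) * 0)) by (f_equal; ring).
      apply (is_lim_seq_scal_l _ _ 0), (is_lim_seq_tail nu (1 / nu) 1 (E / 1)); lra. }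
  assert (Hlim2 : is_lim_seq (fun n => sqrt PI * RInt (hankel (nu / 2) phi xi) (- INR n) (INR n))
                    (sqrt PI * (PI * wright (nu / 2) xi))).
  { apply (is_lim_seq_scal_l _ _ (PI * wright (nu / 2) xi)).
    apply hankel_series; try lra.
    replace (nu / 2 * phi) with (gm / 2) by (unfold gm; field).
    apply cos_gt_0; lra. }
  assert (Hfin : Rabs (PI * I - sqrt PI * (PI * wright (nu / 2) xi))
    <= 2 * exp (/ 2 * A) * G1 + 4 * D * exp (- / 4 * B) * G2).
  { assert (Hl := is_lim_seq_abs _ _ (is_lim_seq_minus' _ _ _ _ Hlim1 Hlim2)).
    apply (is_lim_seq_le _ _ _ _ Hout Hl (is_lim_seq_const _)). }
  replace (PI * I - sqrt PI * (PI * wright (nu / 2) xi))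
    with (PI * (I - sqrt PI * wright (nu / 2) xi)) in Hfin by ring.
  rewrite Rabs_mult (Rabs_pos_eq PI) in Hfin; [| lra].
  apply Rmult_le_reg_l with PI; auto.
  apply Rle_trans with (1 := Hfin).
  replace (PI * ((2 * G1 + 4 * D * G2) / PI * (exp (/ 2 * A) + exp (- / 4 * B))))
    with ((2 * G1 + 4 * D * G2) * (exp (/ 2 * A) + exp (- / 4 * B))) by (field; lra).
  assert (H1 := exp_pos (/ 2 * A)); assert (H2 := exp_pos (- / 4 * B)).
  assert (H3 : 0 <= D * G2 * exp (/ 2 * A)) by (repeat apply Rmult_le_pos; lra).
  assert (H4 : 0 <= G1 * exp (- / 4 * B)) by (apply Rmult_le_pos; lra).
  lra.
Qed.

(** * Return to the variables [w], [x] and [t] *)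

Lemma u_sol_wright (mu lam x t : R) : 0 < lam ->
  u_sol mu lam x t =
  / (2 * lam * Rpower t (mu / 2)) * wright (mu / 2) (Rabs x / (lam * Rpower t (mu / 2))).
Proof.
  intros Hlam; unfold u_sol, wright.
  f_equal; apply Series_ext; intros k; unfold wright_term.
  replace (- Rabs x / (lam * Rpower t (mu / 2))) with (- (Rabs x / (lam * Rpower t (mu / 2))))
    by (unfold Rdiv; ring).
  f_equal; f_equal; rewrite S_INR; field.
Qed.

Lemma sqrt_eq_of_sq (a r : R) : 0 <= r -> r * r = a -> sqrt a = r.
Proof. intros Hr <-; now apply sqrt_square. Qed.

(** The kernel behaves like [w^{-1/2}]; setting aside [/ w], the Jacobian of [r], leaves the
    [w^{1/2}] that appears as [exp (/ 2 * r)]. *)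
Lemma kernel_change_variable (lam nu x t w : R) : 0 < lam -> 0 < w ->
  let T := Rpower t (nu / 2) in
  let xi := Rabs x / (lam * T) in
  let r := ln (w / (lam * T ^ 2)) in
  gauss_kernel lam x w * ubar (2 * nu) lam w t
  = / (2 * lam * T * sqrt PI)
    * (/ w * (exp (/ 2 * r - (xi / 2) ^ 2 * exp (- r)) * wright nu (exp r))).
Proof.
  intros Hlam Hw T xi r; generalize PI_RGT_0; intros HP.
  assert (HT : 0 < T) by apply exp_pos.
  assert (HTT : Rpower t (2 * nu / 2) = T ^ 2).
  { unfold T, Rpower; rewrite exp_pow; f_equal; simpl; field. }
  assert (Hk : 0 < lam * T ^ 2) by (apply Rmult_lt_0_compat; auto; now apply pow_lt).
  assert (Hwk : 0 < w / (lam * T ^ 2)) by now apply Rdiv_lt_0_compat.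
  assert (HsP : 0 < sqrt PI) by now apply sqrt_lt_R0.
  assert (HsP2 : sqrt PI * sqrt PI = PI) by (apply sqrt_sqrt; lra).
  unfold ubar; destruct (Rle_dec 0 w) as [_|H]; [| lra].
  rewrite u_sol_wright; auto.
  replace (2 * nu / 2) with nu in * by field; rewrite HTT.
  rewrite (Rabs_pos_eq w); [| lra].
  assert (Er : exp r = w / (lam * T ^ 2)) by (unfold r; now rewrite exp_ln).
  assert (Er' : exp (- r) = lam * T ^ 2 / w).
  { rewrite exp_Ropp Er; field; lra. }
  rewrite Er Er' /Rminus exp_plus.
  set (h := exp (/ 2 * r)).
  assert (Hh : 0 < h) by apply exp_pos.
  assert (Hh2 : h * h = w / (lam * T ^ 2)) by (unfold h; rewrite -exp_half_sq; auto).
  unfold gauss_kernel.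
  assert (Es : sqrt (4 * PI * w * lam) = 2 * sqrt PI * lam * T * h).
  { apply sqrt_eq_of_sq.
    - repeat apply Rmult_le_pos; lra.
    - transitivity (4 * (sqrt PI * sqrt PI) * lam ^ 2 * T ^ 2 * (h * h)); [ring |].
      rewrite Hh2 HsP2; field; lra. }
  rewrite Es.
  replace (- x ^ 2 / (4 * w * lam)) with (- ((xi / 2) ^ 2 * (lam * T ^ 2 / w))).
  - set (e := exp _); set (W := wright nu _).
    replace (/ w) with (/ (h * h * (lam * T ^ 2))) by (rewrite Hh2; field; lra).
    field; lra.
  - unfold xi; rewrite -(pow2_abs x); field; lra.
Qed.

Lemma is_RInt_gen_subordination (lam nu x t : R) : 0 < lam -> 0 < nu < 1 ->
  is_RInt_gen (fun w => gauss_kernel lam x w * ubar (2 * nu) lam w t)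
    (at_right 0) (Rbar_locally p_infty) (u_sol nu lam x t).
Proof.
  intros Hlam Hnu; generalize PI_RGT_0; intros HP.
  assert (HsP : 0 < sqrt PI) by now apply sqrt_lt_R0.
  set (T := Rpower t (nu / 2)).
  assert (HT : 0 < T) by apply exp_pos.
  set (ka := lam * T ^ 2).
  assert (Hka : 0 < ka) by (apply Rmult_lt_0_compat; auto; now apply pow_lt).
  set (xi := Rabs x / (lam * T)).
  assert (Hxi : 0 <= xi).
  { apply Rdiv_le_0_compat; [apply Rabs_pos | now apply Rmult_lt_0_compat]. }
  set (M := / (2 * lam * T * sqrt PI)).
  assert (HM : 0 < M) by (apply Rinv_0_lt_compat; repeat apply Rmult_lt_0_compat; lra).
  set (h := fun r => exp (/ 2 * r - (xi / 2) ^ 2 * exp (- r)) * wright nu (exp r)).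
  assert (Hh : forall r, continuous h r).
  { intros r; apply (continuous_mult (fun r => exp (/ 2 * r - (xi / 2) ^ 2 * exp (- r)))).
    - revert r; smooth.
    - apply (continuous_comp exp (wright nu)); [apply continuous_exp | now apply continuous_wright]. }
  destruct (wright_subordination nu xi Hnu Hxi) as [C HC]; fold h in HC.
  assert (HI : forall a b, 0 < a <= b ->
     is_RInt (fun w => gauss_kernel lam x w * ubar (2 * nu) lam w t) a b
       (M * RInt h (ln (a / ka)) (ln (b / ka)))).
  { intros a b Hab.
    apply (is_RInt_ext (fun w => scal M (scal (/ w) (h (ln (w / ka)))))).
    - rewrite Rmin_left; [| lra]; intros w Hw.
      rewrite (kernel_change_variable lam nu x t w); auto; lra.
    - apply: is_RInt_scal.
      apply (is_RInt_comp h (fun w => ln (w / ka)) (fun w => / w)).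
      + intros; apply Hh.
      + rewrite Rmin_left; [| lra]; intros w Hw; split.
        * auto_derive; [apply Rmult_lt_0_compat; [lra | now apply Rinv_0_lt_compat] | field; lra].
        * apply: ex_derive_continuous; auto_derive; lra. }
  assert (HL : u_sol nu lam x t = M * (sqrt PI * wright (nu / 2) xi)).
  { rewrite u_sol_wright; auto; fold T; fold xi; unfold M; field; lra. }
  rewrite HL; intros P [eps HP'].
  assert (HC0 : 0 < M * (Rabs C + 1)).
  { apply Rmult_lt_0_compat; auto; generalize (Rabs_pos C); lra. }
  (* Each of the two truncation exponentials will be at most [e], for a total of at most [eps / 2].
     The bound [e <= 1] makes [ln e] nonpositive, which keeps the lower cut below the upper one. *)
  set (e := Rmin 1 (eps / (4 * (M * (Rabs C + 1))))).
  assert (He : 0 < e).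
  { apply Rmin_pos; [lra | apply Rdiv_lt_0_compat; [apply eps | lra]]. }
  assert (He1 : ln e <= 0).
  { rewrite -ln_1; destruct (Rmin_l 1 (eps / (4 * (M * (Rabs C + 1))))) as [H|H]; fold e in H.
    - now apply Rlt_le, ln_increasing.
    - rewrite H; lra. }
  assert (Hd : 0 < ka * exp (2 * ln e)) by (apply Rmult_lt_0_compat; auto; apply exp_pos).
  (* The cuts are [ka e^2] and [ka e^{-4}], the inverses of the rates: in [A = ln (a / ka)] and
     [B = ln (b / ka)] they mean [exp (A / 2) <= e] and [exp (- B / 4) <= e]. *)
  apply (Filter_prod _ _ _ (fun a => 0 < a < ka * exp (2 * ln e)) (fun b => ka * exp (- 4 * ln e) < b)).
  - exists (mkposreal _ Hd); intros a Ha Ha0.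
    unfold ball in Ha; simpl in Ha; unfold AbsRing_ball, abs, minus, plus, opp in Ha; simpl in Ha.
    apply Rabs_lt_between in Ha; lra.
  - now exists (ka * exp (- 4 * ln e)).
  - intros a b Ha Hb; simpl.
    assert (Hae : ka * exp (2 * ln e) <= ka * exp (- 4 * ln e)).
    { apply Rmult_le_compat_l; [lra | apply exp_le; lra]. }
    eexists; split; [apply HI; lra |].
    apply HP'.
    unfold ball; simpl; unfold AbsRing_ball, abs, minus, plus, opp; simpl.
    set (A := ln (a / ka)); set (B := ln (b / ka)).
    assert (Hak : 0 < a / ka) by (apply Rdiv_lt_0_compat; lra).
    assert (HA : A <= 2 * ln e).
    { unfold A; rewrite -(ln_exp (2 * ln e)); apply Rlt_le, ln_increasing; auto.
      apply Rmult_lt_reg_l with ka; auto; replace (ka * (a / ka)) with a by (field; lra); lra. }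
    assert (HB : - 4 * ln e <= B).
    { unfold B; rewrite -(ln_exp (- 4 * ln e)); apply Rlt_le, ln_increasing; [apply exp_pos |].
      apply Rmult_lt_reg_l with ka; auto; replace (ka * (b / ka)) with b by (field; lra); lra. }
    assert (HAe : exp (/ 2 * A) <= e) by (rewrite -(exp_ln e He); apply exp_le; lra).
    assert (HBe : exp (- / 4 * B) <= e) by (rewrite -(exp_ln e He); apply exp_le; lra).
    assert (HC' := HC A B ltac:(lra)).
    replace (_ + _) with (M * (RInt h A B - sqrt PI * wright (nu / 2) xi)) by ring.
    rewrite Rabs_mult (Rabs_pos_eq M); [| lra].
    assert (H1 := exp_pos (/ 2 * A)); assert (H2 := exp_pos (- / 4 * B)).
    apply Rle_lt_trans with (M * ((Rabs C + 1) * (2 * e))).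
    + apply Rmult_le_compat_l; [lra |].
      apply Rle_trans with (1 := HC').
      apply Rle_trans with ((Rabs C + 1) * (exp (/ 2 * A) + exp (- / 4 * B))).
      * apply Rmult_le_compat_r; [lra | generalize (Rle_abs C); lra].
      * apply Rmult_le_compat_l; [generalize (Rabs_pos C); lra | lra].
    + apply Rle_lt_trans with (2 * (M * (Rabs C + 1)) * (eps / (4 * (M * (Rabs C + 1))))).
      * replace (M * ((Rabs C + 1) * (2 * e))) with (2 * (M * (Rabs C + 1)) * e) by ring.
        apply Rmult_le_compat_l; [lra | apply Rmin_r].
      * replace (2 * (M * (Rabs C + 1)) * (eps / (4 * (M * (Rabs C + 1))))) with (eps / 2)
          by (field; generalize (Rabs_pos C); split; lra).
        generalize (cond_pos eps); lra.
Qed.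

(** * The boundary case [nu = 1]: the Wright function of index [1 / 2] is a Gaussian *)

Lemma gauss_lim_half_sub (j : nat) : is_lim_seq (gauss (/ 2 - INR j))
  (INR (Factorial.fact (2 * j)) * (- / 4) ^ j / INR (Factorial.fact j) / sqrt PI).
Proof.
  assert (HsP : 0 < sqrt PI) by apply sqrt_lt_R0, PI_RGT_0.
  induction j as [|j IH].
  - simpl; replace (1 * 1 / 1 / sqrt PI) with (/ gam (/ 2)) by (rewrite gam_half; field; lra).
    rewrite Rminus_0_r; apply gauss_lim_gam; lra.
  - replace (INR (Factorial.fact (2 * S j)) * (- / 4) ^ S j / INR (Factorial.fact (S j)) / sqrt PI)
      with ((/ 2 - INR (S j)) *
        (INR (Factorial.fact (2 * j)) * (- / 4) ^ j / INR (Factorial.fact j) / sqrt PI)).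
    + apply gauss_lim_pred.
      replace (/ 2 - INR (S j) + 1) with (/ 2 - INR j) by (rewrite S_INR; ring); auto.
    + replace (2 * S j)%nat with (S (S (2 * j))) by lia.
      replace (Factorial.fact (S (S (2 * j)))) with (S (S (2 * j)) * (S (2 * j) * Factorial.fact (2 * j)))%nat
        by reflexivity.
      replace (Factorial.fact (S j)) with (S j * Factorial.fact j)%nat by reflexivity.
      change ((- / 4) ^ S j) with (- / 4 * (- / 4) ^ j).
      rewrite !mult_INR !S_INR mult_INR; simpl (INR 2).
      field; repeat split; try lra.
      * apply INR_fact_neq_0.
      * generalize (pos_INR j); lra.
Qed.

Lemma gauss_lim_neg_INR (j : nat) : is_lim_seq (gauss (- INR j)) 0.
Proof.
  induction j as [|j IH].
  - apply is_lim_seq_ext with (u := fun _ => 0); [| apply is_lim_seq_const].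
    intros n; unfold gauss; rewrite rising_shift; simpl; rewrite Ropp_0; unfold Rdiv; ring.
  - replace (Finite 0) with (Finite (- INR (S j) * 0)) by (f_equal; ring).
    apply gauss_lim_pred.
    replace (- INR (S j) + 1) with (- INR j) by (rewrite S_INR; ring); auto.
Qed.

(** The odd terms fall on the poles of [Gamma] and vanish; in the even ones [1 / Gamma (1/2 - n)]
    cancels [(2 n)!] and leaves the exponential series at [- z^2 / 4]. *)
Lemma wright_half (z : R) : wright (/ 2) z = exp (- z ^ 2 / 4) / sqrt PI.
Proof.
  assert (HsP : 0 < sqrt PI) by apply sqrt_lt_R0, PI_RGT_0.
  set (a := fun k => (-1) ^ k / INR (Factorial.fact k) * rgamma (1 - / 2 * INR (S k))).
  assert (H : is_pseries a z (exp (- z ^ 2 / 4) / sqrt PI + z * 0)).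
  { apply is_pseries_odd_even.
    - apply is_pseries_R.
      apply is_series_ext with
        (a := fun n => scal (/ sqrt PI) (/ INR (Factorial.fact n) * (- z ^ 2 / 4) ^ n)).
      + intros n; unfold a.
        replace (1 - / 2 * INR (S (2 * n))) with (/ 2 - INR n)
          by (rewrite S_INR mult_INR; simpl (INR 2); field).
        rewrite (rgamma_of_lim _ _ (gauss_lim_half_sub n)).
        rewrite pow_1_even.
        replace (- z ^ 2 / 4) with ((- / 4) * z ^ 2) by field.
        rewrite Rpow_mult_distr; unfold scal; simpl; unfold mult; simpl.
        field; repeat split; try lra; apply INR_fact_neq_0.
      + replace (exp (- z ^ 2 / 4) / sqrt PI) with (scal (/ sqrt PI) (exp (- z ^ 2 / 4)))
          by (unfold scal; simpl; unfold mult; simpl; field; lra).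
        apply: is_series_scal.
        apply is_pseries_R, is_exp_Reals.
    - apply is_pseries_R.
      apply is_series_ext with (a := fun n => 0).
      + intros n; unfold a.
        replace (1 - / 2 * INR (S (2 * n + 1))) with (- INR n)
          by (rewrite S_INR plus_INR mult_INR; simpl; field).
        rewrite (rgamma_of_lim _ _ (gauss_lim_neg_INR n)); toR; ring.
      + apply (is_lim_seq_ext (fun _ => 0) _ 0); [| apply is_lim_seq_const].
        intros n; rewrite sum_n_const; toR; ring. }
  apply is_pseries_R, is_series_unique in H.
  rewrite Rmult_0_r Rplus_0_r in H; rewrite -H.
  apply Series_ext; intros k; unfold wright_term, a.
  replace (- z) with (-1 * z) by ring; rewrite Rpow_mult_distr; unfold Rdiv; ring.
Qed.

(** For [nu = 1] the equation of order [2] is the wave equation, whose solution is half a Dirac mass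
    at each of [lam t] and [- lam t]; all coefficients [1 / Gamma (- k)] of its series are [0]. The
    doubled restriction to [w >= 0] is the unit mass at [lam t], so the integral against it is the
    kernel evaluated at [w = lam t]. *)
Theorem theorem2p3 (lam nu : R) (hlam : 0 < lam) (hnu : 0 < nu <= 1) :
  forall x t : R, 0 < t ->
    (nu < 1 ->
       is_RInt_gen (fun w => gauss_kernel lam x w * ubar (2 * nu) lam w t)
                   (at_right 0) (Rbar_locally p_infty) (u_sol nu lam x t))
    /\
    (nu = 1 -> u_sol nu lam x t = gauss_kernel lam x (lam * t)).
Proof.
  intros x t Ht; split.
  - intros Hnu; apply is_RInt_gen_subordination; lra.
  - intros ->; generalize PI_RGT_0; intros HP.
    assert (HsP : 0 < sqrt PI) by now apply sqrt_lt_R0.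
    assert (HsP2 : sqrt PI * sqrt PI = PI) by (apply sqrt_sqrt; lra).
    rewrite u_sol_wright; auto.
    set (T := Rpower t (1 / 2)).
    assert (HT : 0 < T) by apply exp_pos.
    assert (HT2 : t = T ^ 2).
    { unfold T, Rpower; rewrite exp_pow; simpl INR.
      replace ((1 + 1) * (1 / 2 * ln t)) with (ln t) by field; now rewrite exp_ln. }
    replace (1 / 2) with (/ 2) by field; rewrite wright_half; unfold gauss_kernel.
    assert (Es : sqrt (4 * PI * (lam * t) * lam) = 2 * lam * T * sqrt PI).
    { apply sqrt_eq_of_sq.
      - repeat apply Rmult_le_pos; lra.
      - rewrite HT2; transitivity (4 * (sqrt PI * sqrt PI) * lam ^ 2 * T ^ 2); [ring |].
        rewrite HsP2; ring. }
    rewrite Es.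
    replace (- (Rabs x / (lam * T)) ^ 2 / 4) with (- x ^ 2 / (4 * (lam * t) * lam)).
    + field; lra.
    + rewrite HT2 -(pow2_abs x); field; lra.
Qed.
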